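(* Assume (A1)–(A8), that every $u\in\tilde{\mathcal B}$ satisfies $\mathcal R(u)=1$ or $u=0$, and that $(\mathcal B,d_{\mathcal B})$ is NPC. Let $n\in\mathbb N$. Then for every initial point $(\mathbf c^0,\mathbf u^0)\in\Omega_\infty^n$ there exists a unique minimizing movement $(\mathbf c_t,\mathbf u_t)$ for $J_n$ in $\Omega_\infty^n$ starting from it. Moreover, for every other initial point $(\tilde{\mathbf c}^0,\tilde{\mathbf u}^0)\in\Omega_\infty^n$ with corresponding minimizing movement $(\tilde{\mathbf c}_t,\tilde{\mathbf u}_t)$, the contraction estimate $$d_n\big((\mathbf c_t,\mathbf u_t),(\tilde{\mathbf c}_t,\tilde{\mathbf u}_t)\big)\le e^{-\lambda t}d_n\big((\mathbf c^0,\mathbf u^0),(\tilde{\mathbf c}^0,\tilde{\mathbf u}^0)\big)\quad\text{for }\mathcal L^1\text{-a.e. }t>0$$ holds for a $\lambda\in\mathbb R$ depending (for fixed $n$, $K$, $\mathcal F$, $\mathcal R$, $\mathcal B$, $d_{\mathcal B}$) only on $|\mathbf c^0|$ and $|\tilde{\mathbf c}^0|$.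
   Context: Let $\mathcal C$ be a separable Banach space, $\mathcal M=\mathcal C^*$ its topological dual with the dual norm, and $Y$ a Hilbert space. Let $K:\mathcal M\to Y$, $\mathcal F:Y\to\mathbb R$, $\mathcal R:\mathcal M\to[0,+\infty]$ and $J(u):=\mathcal F(Ku)+\mathcal R(u)$ for $u\in\mathcal M$. Put $\mathrm{Dom}(\mathcal R):=\{u\in\mathcal M:\mathcal R(u)<+\infty\}$. Let $B:=\{u\in\mathcal M:\mathcal R(u)\le1\}$ and let $\tilde{\mathcal B}:=\overline{\mathrm{Ext}(B)}^{*}$ be the weak$^*$-closure of its set of extremal points. Fix a (nonempty) weak$^*$-closed subset $\mathcal B\subset\tilde{\mathcal B}$ and a metric $d_{\mathcal B}$ metrizing the weak$^*$-convergence on $\mathcal B$, such that $(\mathcal B,d_{\mathcal B})$ is geodesically complete, i.e. any two points are joined by a geodesic; a geodesic in a metric space $(X,d)$ is a curve $\gamma:[0,1]\to X$ with $d(\gamma_s,\gamma_t)=|s-t|d(\gamma_0,\gamma_1)$ for all $s,t$. A geodesic metric space $(X,d)$ is NPC (of global non-positive curvature) if for all geodesics $\gamma:[0,1]\to X$, $w\in X$ and $t\in[0,1]$: $d^2(\gamma_t,w)\le(1-t)d^2(\gamma_0,w)+td^2(\gamma_1,w)-t(1-t)d^2(\gamma_0,\gamma_1)$. Assumptions: (A1) $K$ is linear and weak$^*$-to-weak continuous. (A2) $\mathcal F$ is bounded from below, convex, and twice Fréchet differentiable on $Y$. (A3) $\mathcal R$ is convex, weak$^*$-lower semicontinuous and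 positively one-homogeneous: $\mathcal R(\lambda u)=\lambda\mathcal R(u)$ for all $\lambda\ge0$, $u\in\mathcal M$. (A4) For every $\alpha\ge0$ the sublevel set $\{u\in\mathcal M:\mathcal R(u)\le\alpha\}$ is weak$^*$-compact. (A5) $K$ is sequentially weak$^*$-to-strong continuous on $\mathrm{Dom}(\mathcal R)$. (A6) (no loss of mass) For every $n\in\mathbb N$, $\alpha^1,\dots,\alpha^n\ge0$ and $u^1,\dots,u^n\in\mathcal B$: $\mathcal R(\sum_j\alpha^ju^j)=\sum_j\alpha^j\mathcal R(u^j)$. (A7) $0\notin\mathcal B$. (A8) There is a constant $C=C(K,\mathcal B)>0$ such that for $m\in\{1,2\}$ and all geodesics $u_t:[0,1]\to\mathcal B$, $\sup_{t\in[0,1]}\big\|\frac{d^m}{dt^m}K(u_t)\big\|_Y\le C\,d_{\mathcal B}^m(u_0,u_1)$, where the derivatives (assumed to exist) are understood weakly, i.e. tested against elements of $Y$. Notation: $\Omega_\infty^n:=[0,\infty)^n\times\mathcal B^n$, with elements $(\mathbf c,\mathbf u)=((c^1,\dots,c^n),(u^1,\dots,u^n))$ and metric $d_n((\mathbf c,\mathbf u),(\tilde{\mathbf c},\tilde{\mathbf u})):=\big(\frac1n\sum_{j=1}^n(|c^j-\tilde c^j|^2+d_{\mathcal B}^2(u^j,\tilde u^j))\big)^{1/2}$; $J_n(\mathbf c,\mathbf u):=J\big(\frac1n\sum_{j=1}^n(c^j)^2u^j\big)$. Minimizing movement for $F:X\to(-\infty,\infty]$ on a complete metric space $(X,d)$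 starting from $x_0\in\mathrm{Dom}(F)$: a curve $x:[0,\infty)\to X$ for which there are sequences of time steps $\boldsymbol\tau_k=(\tau_{k,m})_{m\ge1}\subset(0,\infty)$ with $\sum_m\tau_{k,m}=\infty$ and $\sup_m\tau_{k,m}\to0$ as $k\to\infty$, and points $x_k^m$ ($m\ge0$) with $x_k^m\in\arg\min_{v\in X}\{F(v)+\frac1{2\tau_{k,m}}d^2(v,x_k^{m-1})\}$ for $m\ge1$, such that $F(x_k^0)\to F(x_0)$, $\limsup_kd(x_k^0,x_0)<\infty$, and the piecewise constant interpolations $\bar x_k(0)=x_k^0$, $\bar x_k(t)=x_k^m$ for $t\in(\sum_{i<m}\tau_{k,i},\sum_{i\le m}\tau_{k,i}]$ satisfy $\bar x_k(t)\to x_t$ for all $t\ge0$. *)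

(* Defs.v *)
From HB Require Import structures.
From mathcomp Require Import all_boot all_order all_algebra.
From mathcomp Require Import all_classical all_reals all_analysis.

Set Implicit Arguments.
Unset Strict Implicit.
Unset Printing Implicit Defensive.

Import Order.TTheory GRing.Theory Num.Theory.
Import numFieldNormedType.Exports.

Local Open Scope classical_set_scope.
Local Open Scope ring_scope.

Section Dual.
Context {R : realType} (V : normedModType R).

Definition is_dual : {pred (V -> R^o)} :=
  fun f => `[< linear f /\ continuous f >].

Lemma is_dual_submod_closed : submod_closed is_dual.
Proof.
split.
  apply/asboolP; split => [a u v|x]; last exact: cvg_cst.
  by rewrite scaler0 addr0.
move=> a f g /asboolP[lf cf] /asboolP[lg cg]; apply/asboolP; split.
  move=> b u v; rewrite !fctE lf lg !scalerDr !addrA; congr (_ + _).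
  rewrite -!addrA; congr (_ + _); last exact: addrC.
  by rewrite !scalerA mulrC.
by move=> x; apply: cvgD; [apply: cvgZr; exact: cf|exact: cg].
Qed.

HB.instance Definition _ :=
  GRing.isSubmodClosed.Build R (V -> R^o) is_dual is_dual_submod_closed.

(* Its normedModType topology (below) is the one of the dual norm. *)
Record dual := Dual { dual_val :> V -> R^o; dual_valP : dual_val \in is_dual }.

HB.instance Definition _ := [isSub for dual_val].
HB.instance Definition _ := [Choice of dual by <:].
HB.instance Definition _ := [SubChoice_isSubLmodule of dual by <:].

Implicit Types u v : dual.

Lemma dual_linear u : linear u.
Proof. by have /asboolP[] := dual_valP u. Qed.

Lemma dual_continuous u : continuous u.
Proof. by have /asboolP[] := dual_valP u. Qed.

HB.instance Definition _ u :=
  @GRing.isLinear.Build R V R^o _ (dual_val u) (dual_linear u).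

Definition dual_norm u : R := sup [set `|u x| | x in [set x : V | `|x| <= 1]].

Lemma dual_has_sup u :
  has_sup [set `|u x| | x in [set x : V | `|x| <= 1]].
Proof.
split; first by exists `|u 0|, 0 => //=; rewrite normr0 ler01.
have /linear_bounded_continuous/linear_boundedP := @dual_continuous u.
move=> /pinfty_ex_gt0[M M0 uM]; exists M => _ [x /= x1 <-].
by rewrite (le_trans (uM x))// ler_piMr// ltW.
Qed.

Lemma dual_norm_ge u x : `|x| <= 1 -> `|u x| <= dual_norm u.
Proof. by move=> x1; apply: (sup_upper_bound (dual_has_sup u)); exists x. Qed.

Lemma dual_norm_le u r :
  (forall x, `|x| <= 1 -> `|u x| <= r) -> dual_norm u <= r.
Proof.
by move=> ur; apply: ge_sup => [|_ [x x1 <-]]; [case: (dual_has_sup u)|exact: ur].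
Qed.

Lemma dual_normD u v : dual_norm (u + v) <= dual_norm u + dual_norm v.
Proof.
apply: dual_norm_le => x x1.
by rewrite (le_trans (ler_normD _ _))// lerD// dual_norm_ge.
Qed.

Lemma dual_normZ_le a u : dual_norm (a *: u) <= `|a| * dual_norm u.
Proof.
by apply: dual_norm_le => x x1; rewrite normrM ler_wpM2l// dual_norm_ge.
Qed.

Lemma dual_normZ a u : dual_norm (a *: u) = `|a| * dual_norm u.
Proof.
apply/le_anti/andP; split; first exact: dual_normZ_le.
have [->|a0] := eqVneq a 0.
  by rewrite normr0 mul0r (le_trans (normr_ge0 ((0 *: u) 0)))// dual_norm_ge// normr0.
rewrite -ler_pdivlMl ?normr_gt0// -normfV -[leLHS]/(dual_norm u).
by rewrite -[in leLHS](scalerK a0 u) dual_normZ_le.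
Qed.

Lemma dual_norm0_eq0 u : dual_norm u = 0 -> u = 0.
Proof.
move=> u0; apply: val_inj; apply/funext => x /=.
have [->|x0] := eqVneq x 0; first by rewrite -[LHS]/(u 0) raddf0.
have: `|u (`|x|^-1 *: x)| <= 0 by rewrite -u0 dual_norm_ge// normfZV.
rewrite normr_le0 -[X in X == _]/(u (`|x|^-1 *: x)) linearZ/= scaler_eq0.
by rewrite invr_eq0 normr_eq0 (negbTE x0) => /eqP.
Qed.

HB.instance Definition _ := @Lmodule_isNormed.Build R dual
  dual_norm dual_normD dual_normZ dual_norm0_eq0.

End Dual.

Section WeakTopologies.
Context {R : realType} (V : normedModType R).

Definition weak_star : Type :=
  initial_topology (fun u : dual V => (u : {ptws V -> R^o})).

HB.instance Definition _ := Topological.on weak_star.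

Definition weak : Type :=
  initial_topology (fun x : V => (fun f : dual V => f x) : {ptws dual V -> R^o}).

HB.instance Definition _ := Topological.on weak.

Definition weak_star_cvg (us : nat -> dual V) (u : dual V) :=
  (us : nat -> weak_star) @ \oo --> (u : weak_star).

Definition separable := exists2 D : set V, countable D & dense D.

End WeakTopologies.

Definition extreme_points {R : realType} {V : lmodType R} (A : set V) : set V :=
  [set u | A u /\ forall v w (t : R), A v -> A w ->
    0 < t < 1 -> u = t *: v + (1 - t) *: w -> v = w].

Definition ereal_convex {R : realType} {V : lmodType R} (f : V -> \bar R) :=
  forall (u v : V) (t : R), 0 <= t <= 1 ->
    (f (t *: u + (1 - t) *: v)%R <= t%:E * f u + (1 - t)%:E * f v)%E.

Definition twice_differentiable {R : realType} {Y : normedModType R}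
    (f : Y -> R^o) :=
  exists Df : Y -> dual Y, forall y,
    [/\ differentiable f y, 'd f y = Df y :> (Y -> R^o) & differentiable Df y].

Section WeakDerivative.
Context {R : realType} {Y : normedModType R} (dot : {symmetric Y}).

(* [g] has derivative [l] at [t] relative to [0, 1], hence one-sided at the
   endpoints. *)
Definition is_derive01 (g : R -> R) (t l : R) :=
  (g s - g t) / (s - t) @[s --> within `[0, 1] t^'] --> l.

Definition is_weak_derive01 (f f' : R -> Y) :=
  forall (y : Y) (t : R), 0 <= t <= 1 ->
    is_derive01 (fun s => dot (f s) y) t (dot (f' t) y).

End WeakDerivative.

(* A metric space is given by a subset [X] of an ambient type [T] and a function
   [d] that is only relevant on [X]; a curve on an interval is a function on [R]
   whose values outside the interval are irrelevant. *)
Section MetricSpace.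
Context {R : realType} {T : Type} (X : set T) (d : T -> T -> R).

Definition metric_on := [/\
  forall x, X x -> d x x = 0,
  forall x y, X x -> X y -> d x y = 0 -> x = y,
  forall x y, X x -> X y -> d x y = d y x &
  forall x y z, X x -> X y -> X z -> d x z <= d x y + d y z].

Definition geodesic (g : R -> T) :=
  (forall t, 0 <= t <= 1 -> X (g t)) /\
  forall s t, 0 <= s <= 1 -> 0 <= t <= 1 -> d (g s) (g t) = `|s - t| * d (g 0) (g 1).

Definition geodesically_complete :=
  forall x y, X x -> X y -> exists g, [/\ geodesic g, g 0 = x & g 1 = y].

Definition NPC := forall g w t, geodesic g -> X w -> 0 <= t <= 1 ->
  d (g t) w ^+ 2 <= (1 - t) * d (g 0) w ^+ 2 + t * d (g 1) w ^+ 2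
                    - t * (1 - t) * d (g 0) (g 1) ^+ 2.

Definition is_minimizer (G : T -> \bar R) (x : T) :=
  X x /\ forall v, X v -> (G x <= G v)%E.

(* Time steps are indexed from 0: [tau m] is the step from [xs m] to [xs m.+1],
   and [series tau m] is the sum of the first [m] steps. *)
Definition is_interpolation (tau : nat -> R) (xs : nat -> T) (xbar : R -> T) :=
  xbar 0 = xs 0%N /\
  forall m t, series tau m < t <= series tau m.+1 -> xbar t = xs m.+1.

Definition minimizing_movement (F : T -> \bar R) (x0 : T) (x : R -> T) :=
  [/\ X x0, (F x0 < +oo)%E, x 0 = x0 & forall t, 0 <= t -> X (x t)] /\
  exists (tau : nat -> nat -> R) (xs : nat -> nat -> T) (xbar : nat -> R -> T),
    [/\ forall k m, 0 < tau k m,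
        forall k, series (tau k) m @[m --> \oo] --> +oo &
        ereal_sup (range (fun m => (tau k m)%:E)) @[k --> \oo] --> 0%E] /\
    [/\ forall k, X (xs k 0%N),
        forall k m, is_minimizer
          (fun v => (F v + ((2 * tau k m)^-1 * d v (xs k m) ^+ 2)%:E)%E)
          (xs k m.+1),
        F (xs k 0%N) @[k --> \oo] --> F x0 &
        (limn_esup (fun k => (d (xs k 0%N) x0)%:E) < +oo)%E] /\
    (forall k, is_interpolation (tau k) (xs k) (xbar k)) /\
    forall t, 0 <= t -> d (xbar k t) (x t) @[k --> \oo] --> 0.

End MetricSpace.

Definition Btilde {R : realType} {C : normedModType R} (Reg : dual C -> \bar R)
    : set (dual C) :=
  @closure (weak_star C) (extreme_points [set u | (Reg u <= 1)%E]).

Section Particles.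
Context {R : realType} {C Y : normedModType R}.
Variables (n : nat) (B : set (dual C)) (dB : dual C -> dual C -> R).

Definition particles : Type := ('I_n -> R) * ('I_n -> dual C).

Definition Omega : set particles :=
  [set p | (forall j, 0 <= p.1 j) /\ forall j, B (p.2 j)].

Definition dist_n (p q : particles) : R :=
  Num.sqrt (n%:R^-1 * \sum_(j < n)
    (`|p.1 j - q.1 j| ^+ 2 + dB (p.2 j) (q.2 j) ^+ 2)).

Definition enorm (c : 'I_n -> R) : R := Num.sqrt (\sum_(j < n) c j ^+ 2).

Definition energy (K : dual C -> Y) (F : Y -> R) (Reg : dual C -> \bar R)
    (u : dual C) : \bar R :=
  ((F (K u))%:E + Reg u)%E.

Definition energy_n (K : dual C -> Y) (F : Y -> R) (Reg : dual C -> \bar R)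
    (p : particles) : \bar R :=
  energy K F Reg (n%:R^-1 *: \sum_(j < n) p.1 j ^+ 2 *: p.2 j).

End Particles.

Arguments particles {R} C n.
Arguments Omega {R C} n B.
Arguments energy_n {R C Y} n K F Reg.

(* Main.v *)
(**
On Omega the mass condition (A6) together with R = 1 on B turns J_n into the real
function G(c, u) = F(1/n sum_j c_j^2 K u_j) + |c|^2 / n, which is continuous by (A5)
and whose sublevel sets have bounded c, hence are compact. Along a curve that is
affine in c and geodesic in each u_j, the argument of F deviates from its chord by
at most a constant times t (1 - t) d_n^2, by (A8); the gradient of F is bounded on the
compact set of arguments, so convexity of F makes G semiconvex, with a constant that
depends only on a bound for |c|. The d_n^2 inherit the NPC inequality along these
curves.

Testing the minimality of a proximal step against such a curve gives a discrete
evolution variational inequality. Two discrete flows x and y, with arbitrarily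
small steps, are compared on a common coarse grid of mesh h: the inequality for x is
tested with y_(i+1), the one for y with x_i, so that the energies of y cancel, those
of x telescope to O(h), and Gronwall's lemma concludes. This one estimate yields the
convergence of the scheme, the uniqueness of its limit and the contraction. *)

Require Import Defs.
From HB Require Import structures.
From mathcomp Require Import all_boot all_order all_algebra.
From mathcomp Require Import all_classical all_reals all_analysis.
From mathcomp Require Import ring lra.

Set Implicit Arguments.
Unset Strict Implicit.
Unset Printing Implicit Defensive.

Import Order.TTheory GRing.Theory Num.Theory.
Import numFieldNormedType.Exports.

Local Open Scope classical_set_scope.
Local Open Scope ring_scope.

(** * Proximal schemes *)

Section MetricOn.
Context {R : realType} {T : Type} (X : set T) (d : T -> T -> R).
Hypothesis d_metric : metric_on X d.

Lemma metric_on_ge0 x y : X x -> X y -> 0 <= d x y.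
Proof.
move=> Xx Xy; have [dxx _ dC dT] := d_metric.
have := dT x y x Xx Xy Xx; rewrite dxx// (dC y x)//; lra.
Qed.

Lemma metric_on_sub (Z : set T) : Z `<=` X -> metric_on Z d.
Proof.
have [dxx d0 dC dT] := d_metric.
by move=> ZX; split=> [x /ZX/dxx|x y /ZX + /ZX|x y /ZX + /ZX|x y z /ZX + /ZX + /ZX];
  [|exact: d0|exact: dC|exact: dT].
Qed.

(** Factor the difference of the squares: the difference of the distances is at most [d x y], their
    sum at most [2 * D]. *)
Lemma sqr_metric_on_le (D : R) x y z :
  X x -> X y -> X z -> d x z <= D -> d y z <= D ->
  d x z ^+ 2 <= d y z ^+ 2 + 2 * D * d x y.
Proof.
move=> Xx Xy Xz xD yD; have [_ _ _ dT] := d_metric.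
have := dT x y z Xx Xy Xz.
have := metric_on_ge0 Xx Xy; have := metric_on_ge0 Xy Xz.
have := metric_on_ge0 Xx Xz; nra.
Qed.

End MetricOn.

(* [L] is [- lambda / 2] for the usual modulus of convexity [lambda]. *)
Definition semiconvex {R : realType} {T : Type} (X : set T) (d : T -> T -> R)
    (G : T -> R) (L : R) :=
  forall x y, X x -> X y -> exists g : R -> T, forall t, 0 <= t <= 1 ->
    [/\ X (g t),
        forall w, X w -> d (g t) w ^+ 2 <=
          (1 - t) * d x w ^+ 2 + t * d y w ^+ 2 - t * (1 - t) * d x y ^+ 2 &
        G (g t) <= (1 - t) * G x + t * G y + L * (t * (1 - t)) * d x y ^+ 2].

Definition proximal {R : realType} {T : Type} (X : set T) (d : T -> T -> R)
    (G : T -> R) (tau : nat -> R) (xs : nat -> T) :=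
  X (xs 0%N) /\ forall m, X (xs m.+1) /\ forall v, X v ->
    G (xs m.+1) + (2 * tau m)^-1 * d (xs m.+1) (xs m) ^+ 2 <=
    G v + (2 * tau m)^-1 * d v (xs m) ^+ 2.

Definition scheme {R : realType} {T : Type} (X : set T) (d : T -> T -> R)
    (G : T -> R) (eta : R) (tau : nat -> R) (xs : nat -> T) (xbar : R -> T) :=
  [/\ forall m, 0 < tau m, forall m, tau m <= eta,
      series tau m @[m --> \oo] --> +oo,
      proximal X d G tau xs & is_interpolation tau xs xbar].

(** The limit s -> 0. It extracts the first-order term when minimality is tested along a curve. *)
Lemma le0_of_slope {R : realType} (a b : R) :
  (forall s, 0 < s <= 1 -> 0 <= a + s * b) -> 0 <= a.
Proof.
move=> ab; rewrite leNgt; apply/negP => a0.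
have b0 : 0 < b by have := ab 1; rewrite lexx ltr01; lra.
(* For a < 0 < b this s lies in (0, 1], and a + s b = a (b - a) / (2 b - a) is negative. *)
have := ab (- a / (2 * b - a)).
have e : - a / (2 * b - a) * (2 * b - a) = - a by rewrite divfK//; lra.
have s0 : 0 < - a / (2 * b - a) by rewrite divr_gt0//; lra.
set s := - a / _ in e s0 *.
have s1 : s <= 1 by nra.
rewrite s0 s1 => /(_ isT); nra.
Qed.

Section Proximal.
Context {R : realType} {T : Type} (X : set T) (d : T -> T -> R) (G : T -> R).
Context (L D Q : R).
Hypothesis d_metric : metric_on X d.
Hypothesis L_ge0 : 0 <= L.
Hypothesis G_semiconvex : semiconvex X d G L.
Hypothesis d_le : forall x y, X x -> X y -> d x y <= D.
Hypothesis G_osc : forall x y, X x -> X y -> G x - G y <= Q.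

Let d_ge0 := metric_on_ge0 d_metric.

Lemma proximal_in tau xs m : proximal X d G tau xs -> X (xs m).
Proof. by case: m => [|m] [X0 XS]//; case: (XS m). Qed.

(** Each step is tested with its own starting point, where the penalty vanishes. *)
Lemma proximal_nonincr tau xs : (forall m, 0 < tau m) ->
  proximal X d G tau xs -> forall l m, (l <= m)%N -> G (xs m) <= G (xs l).
Proof.
move=> tau0 P l m /subnKC <-; elim: (m - l)%N => [|k IH]; first by rewrite addn0.
rewrite addnS (le_trans _ IH)//; have [_ XS] := P.
have [Xm /(_ _ (proximal_in (l + k) P))] := XS (l + k)%N.
have [dxx _ _ _] := d_metric.
rewrite dxx; last exact: proximal_in P.
have : 0 <= (2 * tau (l + k)%N)^-1 by rewrite invr_ge0 mulr_ge0// ltW.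
have := d_ge0 Xm (proximal_in (l + k) P); nra.
Qed.

(* The minimality of x+ is tested against the curve from x+ to v, at first order
   at x+. *)
Lemma proximal_step tau xs m v : 0 < tau m -> proximal X d G tau xs -> X v ->
  d (xs m.+1) v ^+ 2 - d (xs m) v ^+ 2 <=
  2 * tau m * (G v - G (xs m.+1) + L * d (xs m.+1) v ^+ 2).
Proof.
move=> tau0 P Xv; have Xm := proximal_in m P; have [_ /(_ m)[Xx xP]] := P.
have [dxx _ dC _] := d_metric.
have [g gP] := G_semiconvex Xx Xv.
set x := xs m in Xm xP *; set y := xs m.+1 in Xx xP gP *.
set c := (2 * tau m)^-1 in xP *.
have c0 : 0 < c by rewrite invr_gt0 mulr_gt0.
have ctau : 2 * tau m * c = 1 by rewrite divff// mulf_neq0// gt_eqF.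
(* Multiplied by [2 * tau m] this is the claim with an extra -d(y, x)^2 on the right, which is
   dropped. *)
suff : 0 <= G v - G y + L * d y v ^+ 2
            + c * (d v x ^+ 2 - d y x ^+ 2 - d y v ^+ 2).
  rewrite (dC x v)// => h.
  have : 0 <= 2 * tau m * (G v - G y + L * d y v ^+ 2
            + c * (d v x ^+ 2 - d y x ^+ 2 - d y v ^+ 2)).
    by rewrite mulr_ge0// mulr_ge0// ltW.
  rewrite (mulrDr (2 * tau m) (_ + _)) (mulrA (2 * tau m) c) ctau mul1r.
  have := d_ge0 Xx Xm; nra.
(* The terms of the curve that are quadratic in s leave this coefficient after division by s. *)
apply: (@le0_of_slope _ _ ((c - L) * d y v ^+ 2)) => s /andP[s0 s1].
have s01 : 0 <= s <= 1 by rewrite ltW.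
have [Xg dg Gg] := gP _ s01.
have := xP _ Xg; have := dg _ Xm; clear gP dg xP => dg xP.
rewrite -(pmulr_rge0 _ s0).
have : c * d (g s) x ^+ 2 <= c * ((1 - s) * d y x ^+ 2 + s * d v x ^+ 2
  - s * (1 - s) * d y v ^+ 2) by rewrite ler_wpM2l// ltW.
move: Gg xP; move: (G (g s)) (c * d (g s) x ^+ 2) => Gs Es.
move: (G y) (G v) (d y x ^+ 2) (d v x ^+ 2) (d y v ^+ 2) => a b e f h.
move=> h1 h2 h3.
have : 0 <= (1 - s) * a + s * b + L * (s * (1 - s)) * h +
   c * ((1 - s) * e + s * f - s * (1 - s) * h) - (a + c * e) by lra.
suff -> : (1 - s) * a + s * b + L * (s * (1 - s)) * h +
   c * ((1 - s) * e + s * f - s * (1 - s) * h) - (a + c * e) =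
   s * (b - a + L * h + c * (f - e - h) + s * ((c - L) * h)) by [].
ring.
Qed.

(** Along a discrete flow no squared distance to a point of [X] grows faster than at rate [H]. *)
Let H := 2 * (Q + L * D ^+ 2).

Lemma osc_ge0 x : X x -> 0 <= Q.
Proof. by move=> Xx; have := G_osc Xx Xx; rewrite subrr. Qed.

Lemma sqr_d_le x y : X x -> X y -> d x y ^+ 2 <= D ^+ 2.
Proof.
move=> Xx Xy; rewrite lerXn2r ?nnegrE ?d_ge0 ?d_le//.
exact: le_trans (d_ge0 Xx Xy) (d_le Xx Xy).
Qed.

Lemma diam_ge0 x : X x -> 0 <= D.
Proof. by move=> Xx; rewrite (le_trans (d_ge0 Xx Xx) (d_le Xx Xx)). Qed.

Lemma increment_le x y z : X x -> X y -> X z ->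
  2 * (G y - G x + L * d z y ^+ 2) <= H.
Proof.
move=> Xx Xy Xz; rewrite /H ler_pM2l// lerD ?G_osc// ler_wpM2l//.
exact: sqr_d_le.
Qed.

Section Sequence.
Context (tau : nat -> R) (xs : nat -> T).
Hypothesis tau_gt0 : forall m, 0 < tau m.
Hypothesis xs_prox : proximal X d G tau xs.

Let Xxs m : X (xs m) := proximal_in m xs_prox.

Lemma series_le l m : (l <= m)%N -> series tau l <= series tau m.
Proof.
move=> /subnKC <-; elim: (m - l)%N => [|k IH]; first by rewrite addn0.
rewrite (le_trans IH)// addnS seriesS lerDr; exact: ltW.
Qed.

(** Sum the one-step inequality with v = [xs l], each step at rate at most [H]: Holder continuity of
    exponent 1/2 in time. *)
Lemma proximal_holder l m : (l <= m)%N ->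
  d (xs m) (xs l) ^+ 2 <= H * (series tau m - series tau l).
Proof.
move=> /subnKC <-; elim: (m - l)%N => [|k IH].
  have [dxx _ _ _] := d_metric.
  by rewrite addn0 subrr mulr0 dxx// expr0n.
rewrite addnS seriesS.
have := proximal_step (tau_gt0 (l + k)) xs_prox (Xxs l).
have := increment_le (Xxs (l + k).+1) (Xxs l) (Xxs (l + k).+1).
have := tau_gt0 (l + k)%N; nra.
Qed.

(** The one-step inequality summed over a block: energies in the block are at least the final one,
    and squared distances to v exceed the initial one by at most the Holder error. *)
Lemma proximal_evi l m v h : (l <= m)%N -> X v ->
  h = series tau m - series tau l ->
  d (xs m) v ^+ 2 - d (xs l) v ^+ 2 <=
  2 * h * (G v - G (xs m) + L * (d (xs l) v ^+ 2 + 2 * D * Num.sqrt (H * h))).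
Proof.
move=> lm Xv ->.
set E := G v - _ + _.
suff step k : (k <= m - l)%N ->
  d (xs (l + k)%N) v ^+ 2 - d (xs l) v ^+ 2
    <= 2 * (series tau (l + k)%N - series tau l) * E.
  by have := step (m - l)%N (leqnn _); rewrite subnKC.
elim: k => [|k IH] km; first by rewrite addn0 !subrr mulr0 mul0r.
have {}IH := IH (ltnW km); rewrite addnS seriesS.
have := proximal_step (tau_gt0 (l + k)) xs_prox Xv.
have lkm : ((l + k).+1 <= m)%N by rewrite -addnS -leq_subRL.
suff : G v - G (xs (l + k).+1) + L * d (xs (l + k).+1) v ^+ 2 <= E.
  have := tau_gt0 (l + k)%N; nra.
rewrite lerD//; first by rewrite lerD2l lerN2 (proximal_nonincr tau_gt0 xs_prox).
rewrite ler_wpM2l//.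
apply: (le_trans (sqr_metric_on_le d_metric (Xxs _) (Xxs l) Xv (d_le (Xxs _) Xv)
  (d_le (Xxs l) Xv))).
rewrite lerD2l ler_wpM2l//; first by rewrite mulr_ge0// (diam_ge0 Xv).
rewrite -[leLHS]ger0_norm ?d_ge0// -sqrtr_sqr ler_sqrt; last first.
  rewrite mulr_ge0//; last by rewrite subr_ge0 series_le.
  by rewrite mulr_ge0// addr_ge0 ?(osc_ge0 Xv)// mulr_ge0// sqr_ge0.
apply: (le_trans (proximal_holder _)); first by rewrite -addnS leq_addr.
rewrite ler_wpM2l//.
  by rewrite mulr_ge0// addr_ge0 ?(osc_ge0 Xv)// mulr_ge0// sqr_ge0.
by rewrite lerD2r series_le.
Qed.

End Sequence.

(** Here [z] samples a flow on a grid of mesh [h], and [e] absorbs the mismatch between this grid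
    and the steps of the flow. *)
Definition approx_evi (h e : R) (z : nat -> T) := forall i v, X v ->
  d (z i.+1) v ^+ 2 - d (z i) v ^+ 2 <=
  2 * h * (G v - G (z i.+1) + L * d (z i) v ^+ 2) + e.

(* The inequality for x is tested with y_(i+1) and the one for y with x_i: the
   energies of y cancel and those of x telescope. *)
Lemma approx_evi_contraction (h e : R) x y : 0 <= h -> 0 <= e ->
  (forall i, X (x i)) -> (forall i, X (y i)) ->
  (forall i, G (x i.+1) <= G (x i)) ->
  approx_evi h e x -> approx_evi h e y -> forall N,
  d (x N) (y N) ^+ 2 <= (1 + 4 * h * L) ^+ N *
    (d (x 0%N) (y 0%N) ^+ 2 + 2 * h * (G (x 0%N) - G (x N)) +
     N%:R * (2 * h * L * (h * H + e) + 2 * e)).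
Proof.
move=> h0 e0 Xx Xy Gx xP yP; have [_ _ dC _] := d_metric.
set f := 2 * h * L * _ + _.
have H0 : 0 <= H.
  by rewrite mulr_ge0// addr_ge0 ?(osc_ge0 (Xx 0%N))// mulr_ge0// sqr_ge0.
have f0 : 0 <= f by rewrite addr_ge0// ?mulr_ge0// addr_ge0// mulr_ge0.
elim=> [|N IH]; first by rewrite expr0 mul1r subrr mulr0 mul0r !addr0.
have G0N : G (x N) <= G (x 0%N).
  by elim: N {IH} => // N /(le_trans _); apply.
have step : d (x N.+1) (y N.+1) ^+ 2 <= (1 + 4 * h * L) * d (x N) (y N) ^+ 2
    + 2 * h * (G (x N) - G (x N.+1)) + f.
  have := xP N _ (Xy N.+1); have := yP N _ (Xx N).
  have := increment_le (Xy N.+1) (Xx N) (Xy N).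
  rewrite (dC (y N))// (dC (y N.+1) (x N))// /f => h1 h2 h3.
  (* The crude rate [H] brings the mixed distance back to index N, so that the two terms in [L] add
     up to the factor [4 * h * L]. *)
  have h4 : d (x N) (y N.+1) ^+ 2 <= d (x N) (y N) ^+ 2 + (h * H + e).
    by clearbody H; have := ler_wpM2l h0 h1; lra.
  have hL : 0 <= 2 * h * L by rewrite !mulr_ge0.
  by clearbody H; have := ler_wpM2l hL h4; lra.
set a := 1 + 4 * h * L in IH step *.
have a1 : 1 <= a by rewrite lerDl !mulr_ge0.
have aN : 1 <= a ^+ N by rewrite exprn_ege1.
have r0 : 0 <= 2 * h * (G (x N) - G (x N.+1)) + f.
  by rewrite addr_ge0// !mulr_ge0// subr_ge0.
have h1 := ler_wpM2l (le_trans ler01 a1) IH.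
(* Since a^(N+1) >= 1, the new increment may be multiplied by the same power and so joins the
   bracket. *)
have h2 := ler_wpM2r r0 (mulr_ege1 a1 aN); rewrite mul1r in h2.
apply: (le_trans step); rewrite -[leLHS]addrA; apply: (le_trans (lerD h1 h2)).
rewrite le_eqVlt (exprS a) -(natr1 N); apply/orP; left; apply/eqP.
clearbody a f.
ring.
Qed.

(** The index of the first node not before t, where the interpolation takes its value. *)
Lemma interpolation_index (tau : nat -> R) (xs : nat -> T) xbar t :
  series tau m @[m --> \oo] --> +oo ->
  is_interpolation tau xs xbar -> 0 <= t ->
  exists m, [/\ xbar t = xs m, t <= series tau m &
    forall j, (j < m)%N -> series tau j < t].
Proof.
move=> tauoo [xbar0 xbarS] t0.
have ex : exists m, t <= series tau m.
  by have /cvgryPge/(_ t)[m _ /(_ m (leqnn m))] := tauoo; exists m.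
case: (ex_minnP ex) => m tm mmin; exists m.
have lt_m j : (j < m)%N -> series tau j < t.
  by move=> jm; rewrite ltNge; apply: contraL jm => /mmin; rewrite -leqNgt.
split=> //; case: m => [|m] in tm mmin lt_m *; last first.
  by apply: xbarS; rewrite lt_m//=.
(* For m = 0 the sum is empty, so t = 0, the time whose value is prescribed separately. *)
move: tm; rewrite /series/= big_geq// => tle0.
by rewrite (_ : t = 0)//; apply/eqP; rewrite eq_le tle0.
Qed.

Section Interpolation.
Context (tau : nat -> R) (xs : nat -> T) (xbar : R -> T) (eta : R).
Hypothesis tau_gt0 : forall m, 0 < tau m.
Hypothesis tau_le : forall m, tau m <= eta.
Hypothesis tau_oo : series tau m @[m --> \oo] --> +oo.
Hypothesis xs_prox : proximal X d G tau xs.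
Hypothesis xbarP : is_interpolation tau xs xbar.

Let index t := @interpolation_index tau xs xbar t tau_oo xbarP.

Lemma interpolation_in t : 0 <= t -> X (xbar t).
Proof. by move=> /index[m [-> _ _]]; exact: proximal_in xs_prox. Qed.

Lemma interpolation_le s t m l : s <= t -> t <= series tau m ->
  (forall j, (j < l)%N -> series tau j < s) -> (l <= m)%N.
Proof.
move=> st tm ls; rewrite leqNgt; apply/negP => /ls; apply/negP.
by rewrite -leNgt (le_trans st).
Qed.

Lemma interpolation_nonincr s t : 0 <= s <= t -> G (xbar t) <= G (xbar s).
Proof.
move=> /andP[s0 st]; have [l [-> _ ls]] := index s0.
have [m [-> tm _]] := index (le_trans s0 st).
by apply: (proximal_nonincr tau_gt0 xs_prox); exact: interpolation_le st tm ls.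
Qed.

(** The first summand pays for replacing the time between two nodes by [h], off by at most [eta];
    the second is the error of [proximal_evi] on a block of length at most [h + eta]. *)
Definition interp_error (h : R) :=
  eta * H + 4 * (h + eta) * L * D * Num.sqrt (H * (h + eta)).

Lemma interpolation_evi s t v : 0 <= s <= t -> X v ->
  d (xbar t) v ^+ 2 - d (xbar s) v ^+ 2 <=
  2 * (t - s) * (G v - G (xbar t) + L * d (xbar s) v ^+ 2) + interp_error (t - s).
Proof.
move=> /andP[s0 st] Xv.
have D0 := diam_ge0 Xv; have Q0 := osc_ge0 Xv.
have H0 : 0 <= H by rewrite mulr_ge0// addr_ge0// mulr_ge0// sqr_ge0.
(* The first node not before r overshoots it by at most one step. *)
have Sle r m : 0 <= r -> (forall j, (j < m)%N -> series tau j < r) ->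
    series tau m <= r + eta.
  move=> r0; case: m => [_|m /(_ m (leqnn _)) mr].
    by rewrite /series/= big_geq// addr_ge0// (le_trans _ (tau_le 0%N))// ltW.
  by rewrite seriesS addrC lerD// ltW.
have [l [-> sl ls]] := index s0; have [m [-> tm mt]] := index (le_trans s0 st).
have lm : (l <= m)%N by exact: interpolation_le st tm ls.
have := Sle _ _ s0 ls; have := Sle _ _ (le_trans s0 st) mt => Sm Sl.
have Slm := series_le tau_gt0 lm.
set h' := series tau m - series tau l.
apply: (le_trans (proximal_evi tau_gt0 xs_prox lm Xv (erefl h'))).
have h'0 : 0 <= h' by rewrite subr_ge0.
have h'le : h' <= t - s + eta by rewrite /h'; lra.
have h'ge : t - s - eta <= h' by rewrite /h'; lra.
have Xl := proximal_in l xs_prox; have Xm := proximal_in m xs_prox.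
have A1 := increment_le Xm Xv Xl; have A2 := G_osc Xm Xv.
have B0 : 0 <= L * d (xs l) v ^+ 2 by rewrite mulr_ge0// sqr_ge0.
have C0 : 0 <= L * D ^+ 2 by rewrite mulr_ge0// sqr_ge0.
rewrite (mulrDr L) (addrA (_ - _)) mulrDr /interp_error addrA.
(* As [h'] may be longer or shorter than t - s, the bracket is bounded on both sides: above by [A1],
   below by [A2]. *)
apply: lerD; first by move: A1; rewrite /H; nra.
have sq : Num.sqrt (H * h') <= Num.sqrt (H * (t - s + eta)).
  by rewrite ler_wsqrtr// ler_wpM2l.
have LD : 0 <= L * D by rewrite mulr_ge0.
have := ler_pM h'0 (sqrtr_ge0 _) h'le sq => /(ler_wpM2l LD); lra.
Qed.

End Interpolation.

(** Both flows are sampled on the grid of mesh h = t / N; with steps of size at most h / N the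
    accumulated error is of order sqrt h. *)
Lemma interpolation_compare (t eps : R) : X !=set0 -> 0 < t -> 0 < eps ->
  exists2 eta : R, 0 < eta & forall (tau sig : nat -> R) xs ys xbar ybar,
    scheme X d G eta tau xs xbar -> scheme X d G eta sig ys ybar ->
    d (xbar t) (ybar t) ^+ 2 <=
    expR (4 * L * t) * (d (xs 0%N) (ys 0%N) ^+ 2 + eps).
Proof.
move=> [x0 Xx0] t0 eps0.
have D0 := diam_ge0 Xx0; have Q0 := osc_ge0 Xx0.
have H0 : 0 <= H by rewrite mulr_ge0// addr_ge0// mulr_ge0// sqr_ge0.
(* The whole error will be at most [s * (P1 + P2)], where [s] is the square root of the mesh; once
   [s <= r], it is below [eps]. *)
pose P1 := 2 * Q + 2 * t * L * H + (2 * t * L + 2) * H.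
pose P2 := (2 * t * L + 2) * (8 * t * L * D * Num.sqrt (2 * H)).
have tL0 : 0 <= 2 * t * L by rewrite !mulr_ge0// ltW.
have P10 : 0 <= P1 by rewrite /P1; nra.
have P20 : 0 <= P2 by rewrite /P2 !mulr_ge0// ?addr_ge0 ?sqrtr_ge0// ltW.
pose r := Num.min 1 (eps / (P1 + P2 + 1)).
have P0 : 0 < P1 + P2 + 1 by lra.
have r0 : 0 < r by rewrite lt_min ltr01 divr_gt0.
have r1 : r <= 1 by rewrite ge_min lexx.
have rP : r * (P1 + P2) <= eps.
  have : r <= eps / (P1 + P2 + 1) by rewrite ge_min lexx orbT.
  rewrite ler_pdivlMr//; lra.
pose N := (Num.bound (t / r ^+ 2)).+1.
have N0 : 0 < N%:R :> R by rewrite ltr0n.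
have N1 : 1 <= N%:R :> R by rewrite ler1n.
pose h := t / N%:R.
have hN : N%:R * h = t by rewrite mulrC divfK// gt_eqF.
have h0 : 0 < h by rewrite divr_gt0.
have hr : h <= r ^+ 2.
  rewrite ler_pdivrMr// mulrC -ler_pdivrMr ?exprn_gt0//.
  apply: le_trans (_ : (Num.bound (t / r ^+ 2))%:R <= _); last by rewrite ler_nat.
  by rewrite ltW// archi_boundP// divr_ge0 ?sqr_ge0// ltW.
pose s := Num.sqrt h.
have s0 : 0 <= s by exact: sqrtr_ge0.
have ss : s ^+ 2 = h by rewrite sqr_sqrtr// ltW.
have sr : s <= r by rewrite -(ger0_norm (ltW r0)) -sqrtr_sqr ler_wsqrtr.
(* This makes the part [eta * H] of the interpolation error add up to only [h * H] over the N
   intervals. *)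
pose eta := h / N%:R.
have eta0 : 0 < eta by rewrite divr_gt0.
have etaN : N%:R * eta = h by rewrite mulrC divfK// gt_eqF.
have etah : eta <= h by rewrite ler_piMr ?invf_le1// ltW.
exists eta => // tau sig xs ys xbar ybar [tau0 tau_le tauoo xsP xbarP].
move=> [sig0 sig_le sigoo ysP ybarP].
pose e := interp_error eta h.
have e0 : 0 <= e.
  have [h0' eta0'] := (ltW h0, ltW eta0).
  rewrite /e /interp_error; clearbody H eta; clearbody h.
  by rewrite !(addr_ge0, mulr_ge0, sqrtr_ge0).
have Ne : N%:R * e <= h * H + 8 * t * L * D * (Num.sqrt (2 * H) * s).
  have H20 : 0 <= 2 * H by clearbody H; lra.
  rewrite /e /interp_error mulrDr mulrA etaN lerD2l -(sqrtrM h H20).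
  have sq : Num.sqrt (H * (h + eta)) <= Num.sqrt (2 * H * h).
    by rewrite ler_wsqrtr//; nra.
  have LD : 0 <= L * D by rewrite mulr_ge0.
  have le2t : N%:R * (h + eta) <= 2 * t.
    by rewrite mulrDr hN etaN -hN; nra.
  have ge0 : 0 <= N%:R * (h + eta) by rewrite mulr_ge0 ?(ltW N0)// ltW// addr_gt0.
  have := ler_wpM2l LD (ler_pM ge0 (sqrtr_ge0 _) le2t sq).
  by clearbody H; lra.
have grid0 i : 0 <= i%:R * h by rewrite mulr_ge0// ltW.
have gridS i : 0 <= i%:R * h <= i.+1%:R * h.
  by rewrite grid0 ler_wpM2r ?ler_nat// ltW.
have gridB i : i.+1%:R * h - i%:R * h = h by rewrite -natr1; ring.
have xevi : approx_evi h e (fun i => xbar (i%:R * h)).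
  move=> i v Xv; have := interpolation_evi tau0 tau_le tauoo xsP xbarP (gridS i) Xv.
  by rewrite gridB.
have yevi : approx_evi h e (fun i => ybar (i%:R * h)).
  move=> i v Xv; have := interpolation_evi sig0 sig_le sigoo ysP ybarP (gridS i) Xv.
  by rewrite gridB.
have := approx_evi_contraction (ltW h0) e0
  (fun i => interpolation_in tauoo xsP xbarP (grid0 i))
  (fun i => interpolation_in sigoo ysP ybarP (grid0 i))
  (fun i => interpolation_nonincr tau0 tauoo xsP xbarP (gridS i)) xevi yevi N.
rewrite /= hN mul0r; have [-> _] := xbarP; have [-> _] := ybarP.
move=> /le_trans; apply.
set B := _ + _ + _; set B' := _ + eps.
have B'0 : 0 <= B' by rewrite addr_ge0 ?sqr_ge0// ltW.
have BB' : B <= B'.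
  rewrite /B /B' -addrA lerD2l (le_trans _ rP)//.
  have osc := G_osc (proximal_in 0%N xsP) (interpolation_in tauoo xsP xbarP (ltW t0)).
  have eNe : e <= N%:R * e by rewrite ler_peMl.
  have hs : h <= s by rewrite -ss; nra.
  have -> : N%:R * (2 * h * L * (h * H + e) + 2 * e) =
      2 * t * L * (h * H + e) + 2 * (N%:R * e).
    by rewrite -[in RHS]hN; clearbody e H; ring.
  rewrite (le_trans _ (_ : s * (P1 + P2) <= _))//; last first.
    by rewrite ler_wpM2r// addr_ge0.
  set E := N%:R * e in Ne eNe *; set c := 8 * t * L * D * Num.sqrt (2 * H).
  have {}Ne : E <= h * H + c * s by rewrite /c -(mulrA (_ * D)).
  have h1 := ler_wpM2l (ltW h0) osc.
  have h2 := ler_wpM2l tL0 eNe.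
  have h3 := ler_wpM2l (addr_ge0 tL0 (ler0n R 2)) Ne.
  have h4 : h * (2 * Q + 2 * t * L * H + (2 * t * L + 2) * H) <= s * P1.
    by rewrite ler_wpM2r.
  have h5 : s * P2 = (2 * t * L + 2) * (c * s) by rewrite /P2 /c; ring.
  clearbody E c H e; lra.
apply: (le_trans (ler_wpM2l _ BB')).
  by rewrite exprn_ge0// addr_ge0// !mulr_ge0// ltW.
(* The discrete growth factor is dominated through (1 + x)^N <= exp(N x). *)
rewrite ler_wpM2r// -hN.
rewrite (_ : 4 * L * (N%:R * h) = N%:R * (4 * h * L)); last by ring.
rewrite expRM_natl lerXn2r ?nnegrE ?expR_ge0 ?expR_ge1Dx// addr_ge0// !mulr_ge0//.
exact: ltW.
Qed.

End Proximal.

(** * Sequential compactness *)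

(** The extraction is not asked to increase: [k <= phi k] is enough to carry limits over, and it is
    stable under composition. *)
Definition seq_compact {R : realType} {T : Type} (X : set T) (d : T -> T -> R) :=
  forall u : nat -> T, (forall k, X (u k)) -> exists phi l,
    [/\ forall k, (k <= phi k)%N, X l & d (u (phi k)) l @[k --> \oo] --> 0].

(** Sequential, because [d] is a bare function on a type without topology. *)
Definition seq_continuous {R : realType} {T : Type} (X : set T)
    (d : T -> T -> R) {V : topologicalType} (f : T -> V) :=
  forall (u : nat -> T) l, (forall k, X (u k)) -> X l ->
    d (u k) l @[k --> \oo] --> 0 -> f (u k) @[k --> \oo] --> f l.

Lemma cvg_extraction (phi : nat -> nat) :
  (forall k, (k <= phi k)%N) -> phi k @[k --> \oo] --> \oo.
Proof.
move=> phik A [N _ NA]; exists N => // k /= Nk; apply: NA => /=.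
exact: leq_trans (phik k).
Qed.

Lemma cvg_subseq {V : topologicalType} (u : nat -> V) (l : V) (phi : nat -> nat) :
  (forall k, (k <= phi k)%N) -> u k @[k --> \oo] --> l ->
  u (phi k) @[k --> \oo] --> l.
Proof. by move=> /cvg_extraction/cvg_comp; apply. Qed.

Lemma cvg_dist_le {R : realType} {V : normedModType R} (u : nat -> V)
    (v : nat -> R) (l : V) :
  (forall k, `|u k - l| <= v k) -> v k @[k --> \oo] --> 0 ->
  u k @[k --> \oo] --> l.
Proof.
move=> uv /cvgrPdist_le v0; apply/cvgrPdist_le => e /v0[N _ NP].
exists N => // k /NP /=; rewrite sub0r normrN distrC; apply: le_trans.
exact: le_trans (uv k) (ler_norm _).
Qed.

Section Limits.
Context {R : realType} {T : Type} (X : set T) (d : T -> T -> R).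
Hypothesis d_metric : metric_on X d.

(** By the quadrilateral inequality. *)
Lemma metric_on_cvg (u v : nat -> T) x y : (forall k, X (u k)) ->
  (forall k, X (v k)) -> X x -> X y ->
  d (u k) x @[k --> \oo] --> 0 -> d (v k) y @[k --> \oo] --> 0 ->
  d (u k) (v k) @[k --> \oo] --> d x y.
Proof.
move=> Xu Xv Xx Xy ux vy.
apply: (@cvg_dist_le _ R^o _ (fun k => d (u k) x + d (v k) y)); last first.
  by rewrite -(addr0 0); exact: cvgD.
move=> k; have [_ _ dC dT] := d_metric; rewrite ler_distl; apply/andP; split.
  have := dT x (u k) y Xx (Xu k) Xy; have := dT (u k) (v k) y (Xu k) (Xv k) Xy.
  rewrite (dC x (u k))//; lra.
have := dT (u k) x (v k) (Xu k) Xx (Xv k); have := dT x y (v k) Xx Xy (Xv k).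
rewrite (dC y (v k))//; lra.
Qed.

Lemma metric_on_continuous x : X x -> seq_continuous X d (d ^~ x).
Proof.
move=> Xx u l Xu Xl ul; apply: (metric_on_cvg Xu _ Xl Xx ul) => //.
by have [dxx _ _ _] := d_metric; under eq_fun do rewrite dxx//; exact: cvg_cst.
Qed.

Hypothesis X_compact : seq_compact X d.

(** The direct method; compactness is used a first time to exclude that f is unbounded below. *)
Lemma seq_compact_min (f : T -> R) : X !=set0 -> seq_continuous X d f ->
  exists2 x, X x & forall y, X y -> f x <= f y.
Proof.
move=> X0 fc.
have [M Mf] : exists M, forall x, X x -> M <= f x.
  apply: contrapT => /forallNP nM.
  have /choice[u uP] k : exists x, X x /\ f x < - k%:R.
    have /existsNP[x /not_implyP[Xx /negP]] := nM (- k%:R).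
    by rewrite -ltNge; exists x.
  have [phi [l [phik Xl ul]]] := X_compact (fun k => (uP k).1).
  have := fc _ _ (fun k => (uP (phi k)).1) Xl ul.
  move=> /cvgr_ge/(_ (f l - 1)); rewrite ltrBlDr ltrDl ltr01 => /(_ isT)[N _ NP].
  have := NP (maxn N (Num.bound `|1 - f l|)) (leq_maxl _ _); apply/negP.
  rewrite -ltNge; apply: (lt_le_trans (uP _).2).
  set m := maxn _ _; rewrite lerNl opprB.
  apply: (le_trans (ler_norm _)).
  apply: (le_trans (ltW (archi_boundP (normr_ge0 _)))); rewrite ler_nat.
  by rewrite (leq_trans _ (phik m))// leq_maxr.
have [x0 Xx0] := X0.
have E0 : has_inf (f @` X).
  by split; [exists (f x0), x0|exists M => _ [x Xx <-]; exact: Mf].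
have /choice[u uP] k : exists x, X x /\ f x < inf (f @` X) + k.+1%:R^-1.
  have k0 : 0 < k.+1%:R^-1 :> R by rewrite invr_gt0.
  have [_ [x Xx <-] ?] := inf_adherent k0 E0.
  by exists x.
have [phi [l [phik Xl ul]]] := X_compact (fun k => (uP k).1).
exists l => // y Xy.
have fl := fc _ _ (fun k => (uP (phi k)).1) Xl ul.
apply: (le_trans _ (ge_inf E0.2 (ex_intro2 _ _ y Xy erefl))).
have hl : inf (f @` X) + (phi k).+1%:R^-1 @[k --> \oo] --> inf (f @` X) + 0.
  apply: cvgD; first exact: cvg_cst.
  exact: cvg_subseq phik (@cvg_harmonic R).
rewrite -(addr0 (inf _)); apply: (ler_cvg_to fl hl).
by apply: nearW => k; exact/ltW/(uP _).2.
Qed.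

Lemma seq_compact_bounded (f : T -> R) : seq_continuous X d f ->
  exists2 M, 0 <= M & forall x, X x -> `|f x| <= M.
Proof.
move=> fc; have [->|/set0P X0] := eqVneq X set0; first by exists 0.
have fNc : seq_continuous X d (fun x => - f x).
  by move=> u l Xu Xl ul; apply: cvgN; exact: fc.
have [x Xx xP] := seq_compact_min X0 fc.
have [y Xy yP] := seq_compact_min X0 fNc.
exists (`|f x| + `|f y|) => // z Xz.
have := xP z Xz; have := yP z Xz; rewrite lerN2.
by case: (ger0P (f x)); case: (ger0P (f y)); case: (ger0P (f z)); lra.
Qed.

Lemma seq_compact_diam : exists2 D, 0 <= D &
  forall x y, X x -> X y -> d x y <= D.
Proof.
have [->|/set0P[x0 Xx0]] := eqVneq X set0; first by exists 0.
have [M M0 dM] := seq_compact_bounded (metric_on_continuous Xx0).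
exists (M + M) => [|x y Xx Xy]; first exact: addr_ge0.
have [_ _ dC dT] := d_metric; apply: (le_trans (dT x x0 y Xx Xx0 Xy)).
rewrite (dC x0)//; apply: lerD; exact: le_trans (ler_norm _) (dM _ _).
Qed.

(** A Cauchy sequence follows any convergent extraction of it. *)
Lemma seq_compact_complete (u : nat -> T) : (forall k, X (u k)) ->
  (forall e, 0 < e -> exists N, forall k l, (N <= k)%N -> (N <= l)%N ->
     d (u k) (u l) < e) ->
  exists2 l, X l & d (u k) l @[k --> \oo] --> 0.
Proof.
move=> Xu uC; have [phi [l [phik Xl ul]]] := X_compact Xu; exists l => //.
apply/cvgrPdist_lt => e e0; have e20 : 0 < e / 2 by rewrite divr_gt0.
have [N NC] := uC _ e20; move/cvgrPdist_lt/(_ _ e20): ul => [M _ MP].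
exists N => // k /= Nk; pose m := maxn N M.
have := MP m (leq_maxr _ _) => /=; rewrite !sub0r !normrN => h1.
have [_ _ _ dT] := d_metric.
rewrite ger0_norm ?(metric_on_ge0 d_metric)//.
have := dT (u k) (u (phi m)) l (Xu k) (Xu _) Xl.
have := NC k (phi m) Nk (leq_trans (leq_maxl _ _) (phik m)).
have := ler_norm (d (u (phi m)) l); lra.
Qed.

End Limits.

(** * Limits of proximal schemes *)

Lemma interpolation_exists {R : realType} {T : Type} (tau : nat -> R)
    (xs : nat -> T) :
  (forall m, 0 < tau m) -> series tau m @[m --> \oo] --> +oo ->
  exists xbar, is_interpolation tau xs xbar.
Proof.
move=> tau0 tauoo.
have ex t : exists m, t <= series tau m.
  by have /cvgryPge/(_ t)[m _ /(_ m (leqnn m))] := tauoo; exists m.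
exists (fun t => xs (ex_minn (ex t))); split=> [|m t /andP[mt tm]].
  case: ex_minnP => m _ /(_ 0%N); rewrite /series/= big_geq// lexx => /(_ isT).
  by rewrite leqn0 => /eqP ->.
case: ex_minnP => l tl /(_ _ tm) lm; congr xs; apply/eqP.
rewrite eqn_leq lm ltnNge; apply/negP => /(series_le tau0).
by move=> /(le_trans tl); rewrite leNgt mt.
Qed.

Lemma series_cst_oo {R : realType} (c : R) : 0 < c ->
  series (fun=> c) m @[m --> \oo] --> +oo.
Proof.
move=> c0; apply/cvgryPge => A; exists (Num.bound (`|A| / c)) => // m /= mA.
rewrite /series/= sumr_const_nat subn0 -mulr_natl -ler_pdivrMr//.
apply: le_trans (_ : `|A| / c <= _).
  by rewrite ler_pM2r ?invr_gt0// ler_norm.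
apply: (le_trans (ltW (archi_boundP _))); last by rewrite ler_nat.
by rewrite divr_ge0// ltW.
Qed.

Section Flow.
(** [Z] is the whole metric space; [X] is a compact part of it, in applications one that contains a
    sublevel set of the energy. *)
Context {R : realType} {T : Type} (Z X : set T) (d : T -> T -> R) (G : T -> R).
Context (L : R).
Hypothesis d_metric : metric_on Z d.
Hypothesis X_sub : X `<=` Z.
Hypothesis X_compact : seq_compact X d.
Hypothesis G_cont : seq_continuous X d G.
Hypothesis L_ge0 : 0 <= L.
Hypothesis G_semiconvex : semiconvex X d G L.

Let dX_metric := metric_on_sub d_metric X_sub.

Lemma proximal_exists (tau : nat -> R) x0 : X x0 ->
  exists xs, xs 0%N = x0 /\ proximal X d G tau xs.
Proof.
move=> Xx0; have [_ _ dC _] := dX_metric.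
have /choice[f fP] (mx : nat * T) : exists y, X mx.2 -> X y /\ forall v, X v ->
    G y + (2 * tau mx.1)^-1 * d y mx.2 ^+ 2 <=
    G v + (2 * tau mx.1)^-1 * d v mx.2 ^+ 2.
  case: mx => m x /=.
  (* The function to be chosen is total; outside [X] its value is a dummy. *)
  have [Xx|nXx] := pselect (X x); last by exists x.
  have fc : seq_continuous X d (fun v => G v + (2 * tau m)^-1 * d v x ^+ 2).
    move=> u l Xu Xl ul; apply: cvgD; first exact: G_cont.
    apply: cvgMr; rewrite expr2; under eq_fun do rewrite expr2.
    by apply: cvgM; exact: (metric_on_continuous dX_metric Xx).
  by have [y Xy yP] := seq_compact_min X_compact (ex_intro _ _ Xx0) fc; exists y.
pose xs := fix xs m := if m is m'.+1 then f (m', xs m') else x0.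
have Xxs m : X (xs m) by elim: m => // m Xm; case: (fP (m, xs m) Xm).
by exists xs; do 2!split=> //; move=> m; have [] := fP (m, xs m) (Xxs m).
Qed.

(** Compactness supplies the diameter and the oscillation of the energy required by
    [interpolation_compare]. *)
Lemma scheme_compare (t eps : R) : 0 <= t -> 0 < eps ->
  exists2 eta : R, 0 < eta & forall (tau sig : nat -> R) xs ys xbar ybar,
    scheme X d G eta tau xs xbar -> scheme X d G eta sig ys ybar ->
    d (xbar t) (ybar t) ^+ 2 <=
    expR (4 * L * t) * (d (xs 0%N) (ys 0%N) ^+ 2 + eps).
Proof.
move=> t0 eps0; have [X0|/set0P X0] := eqVneq X set0.
  by exists 1 => // tau sig xs ys xbar ybar [_ _ _ []]; rewrite X0.
have [t_eq0|t_gt0] := eqVneq t 0.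
  exists 1 => // tau sig xs ys xbar ybar [_ _ _ _ [x0 _]] [_ _ _ _ [y0 _]].
  by rewrite t_eq0 mulr0 expR0 mul1r x0 y0 lerDl ltW.
have [D D0 dD] := seq_compact_diam dX_metric X_compact.
have [M M0 GM] := seq_compact_bounded X_compact G_cont.
have Gosc x y : X x -> X y -> G x - G y <= M + M.
  move=> /GM; rewrite ler_norml => /andP[_ h] /GM.
  by rewrite ler_norml => /andP[h' _]; lra.
by apply: (interpolation_compare dX_metric L_ge0 G_semiconvex dD Gosc) => //;
  rewrite lt_neqAle eq_sym t_gt0.
Qed.

(** Schemes with constant steps 1/(k+1) and a common start differ only by the error of
    [scheme_compare], hence are Cauchy at each time. *)
Lemma flow_exists x0 : X x0 -> exists (x : R -> T) xs xbar,
  [/\ x 0 = x0, forall t, 0 <= t -> X (x t), forall k, xs k 0%N = x0,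
      forall k, scheme X d G k.+1%:R^-1 (fun=> k.+1%:R^-1) (xs k) (xbar k) &
      forall t, 0 <= t -> d (xbar k t) (x t) @[k --> \oo] --> 0].
Proof.
move=> Xx0; have [dxx d0 _ _] := dX_metric.
have tau0 k : 0 < k.+1%:R^-1 :> R by rewrite invr_gt0.
have /choice[s sP] k : exists s : (nat -> T) * (R -> T), s.1 0%N = x0 /\
    scheme X d G k.+1%:R^-1 (fun=> k.+1%:R^-1) s.1 s.2.
  have [xs [xs0 xsP]] := proximal_exists (fun=> k.+1%:R^-1) Xx0.
  have [xbar xbarP] :=
    interpolation_exists xs (fun=> tau0 k) (series_cst_oo (tau0 k)).
  by exists (xs, xbar); split=> //; split=> //; exact: series_cst_oo.
have Xbar k t : 0 <= t -> X ((s k).2 t).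
  by move=> t0; have [_ [_ _ oo P I]] := sP k; exact: (interpolation_in oo P I t0).
have /choice[x xP] t : exists y, 0 <= t -> X y /\ d ((s k).2 t) y @[k --> \oo] --> 0.
  have [t0|tN] := leP 0 t; last by exists x0.
  have [||y Xy yP] :=
    seq_compact_complete dX_metric X_compact (u := fun k => (s k).2 t).
  - by move=> k; exact: Xbar.
  (* With this error the squared distance comes out at most e^2 / 2. *)
  - move=> e e0; have ex0 : 0 < e ^+ 2 / 2 / expR (4 * L * t).
      by rewrite !divr_gt0// ?expR_gt0// exprn_gt0.
    have [eta eta0 etaP] := scheme_compare t0 ex0.
    have [N _ NP] : \forall k \near \oo, `|0 - harmonic k| < eta.
      by move: eta eta0 {etaP}; exact/cvgrPdist_lt/cvg_harmonic.
    have Neta k : (N <= k)%N ->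
        scheme X d G eta (fun=> k.+1%:R^-1) (s k).1 (s k).2.
      move=> Nk; have [_ [? ? ? ? ?]] := sP k; split=> // _.
      have := NP k Nk; rewrite /= sub0r normrN => /ltW; apply: le_trans.
      exact: ler_norm.
    exists N => k l /Neta Sk /Neta Sl; have := etaP _ _ _ _ _ _ Sk Sl.
    have [-> _] := sP k; have [-> _] := sP l.
    rewrite dxx// expr0n add0r mulrC divfK ?gt_eqF ?expR_gt0// => h.
    have dge := metric_on_ge0 dX_metric (Xbar k t t0) (Xbar l t t0).
    rewrite -(ltr_pXn2r (n := 2)) ?nnegrE ?(ltW e0)//.
    by rewrite (le_lt_trans h)// gtr_pMr ?exprn_gt0// invf_lt1// ltr1n.
  - by exists y.
exists x, (fun k => (s k).1), (fun k => (s k).2); split.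
- have [Xx xlim] := xP 0 (lexx 0).
  have x0s k : (s k).2 0 = x0 by have [<- [_ _ _ _ []]] := sP k.
  move: xlim; under eq_fun do rewrite x0s.
  move=> /(cvg_lim (@Rhausdorff R)); rewrite lim_cst; last exact: Rhausdorff.
  by move=> e; apply/esym/(d0 _ _ Xx0 Xx).
- by move=> t /xP[].
- by move=> k; case: (sP k).
- by move=> k; case: (sP k).
- by move=> t /xP[].
Qed.

(** The limit of [scheme_compare]. The schemes are known to lie in [X] only for large k, so
    membership for every k is stated in [Z]. *)
Lemma flow_contraction (tau sig : nat -> nat -> R) (xs ys : nat -> nat -> T)
    (xbar ybar : nat -> R -> T) x0 y0 x y (t : R) : 0 <= t ->
  (forall eta, 0 < eta -> \forall k \near \oo,
    scheme X d G eta (tau k) (xs k) (xbar k)) ->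
  (forall eta, 0 < eta -> \forall k \near \oo,
    scheme X d G eta (sig k) (ys k) (ybar k)) ->
  (forall k, Z (xs k 0%N)) -> (forall k, Z (ys k 0%N)) ->
  (forall k, Z (xbar k t)) -> (forall k, Z (ybar k t)) ->
  Z x0 -> Z y0 -> Z x -> Z y ->
  d (xs k 0%N) x0 @[k --> \oo] --> 0 -> d (ys k 0%N) y0 @[k --> \oo] --> 0 ->
  d (xbar k t) x @[k --> \oo] --> 0 -> d (ybar k t) y @[k --> \oo] --> 0 ->
  d x y ^+ 2 <= expR (4 * L * t) * d x0 y0 ^+ 2.
Proof.
move=> t0 Sx Sy Zxs Zys Zxb Zyb Zx0 Zy0 Zx Zy xs0 ys0 xbx yby.
apply/ler_addgt0Pr => e e0.
have e'0 : 0 < e / expR (4 * L * t) by rewrite divr_gt0// expR_gt0.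
have [eta eta0 etaP] := scheme_compare t0 e'0.
have h0 : expR (4 * L * t) * (d (xs k 0%N) (ys k 0%N) ^+ 2 + e / expR (4 * L * t))
    @[k --> \oo] --> expR (4 * L * t) * (d x0 y0 ^+ 2 + e / expR (4 * L * t)).
  apply: cvgMr; apply: cvgD; last exact: cvg_cst.
  rewrite expr2; under eq_fun do rewrite expr2.
  by apply: cvgM; exact: (metric_on_cvg d_metric).
have h1 : d (xbar k t) (ybar k t) ^+ 2 @[k --> \oo] --> d x y ^+ 2.
  rewrite expr2; under eq_fun do rewrite expr2.
  by apply: cvgM; exact: (metric_on_cvg d_metric).
have := ler_cvg_to h1 h0.
rewrite mulrDr [X in _ + X]mulrC divfK ?gt_eqF ?expR_gt0//; apply.
by apply: filterS2 (Sx _ eta0) (Sy _ eta0) => k; exact: etaP.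
Qed.

End Flow.

(** * The product metric *)

Lemma minkowski_sum {R : realType} (I : finType) (a b : I -> R) :
  Num.sqrt (\sum_i (a i + b i) ^+ 2) <=
  Num.sqrt (\sum_i a i ^+ 2) + Num.sqrt (\sum_i b i ^+ 2).
Proof.
set P := \sum_i a i ^+ 2; set Q := \sum_i b i ^+ 2.
have P0 : 0 <= P by apply: sumr_ge0 => i _; exact: sqr_ge0.
have Q0 : 0 <= Q by apply: sumr_ge0 => i _; exact: sqr_ge0.
set p := Num.sqrt P; set q := Num.sqrt Q.
have p0 : 0 <= p := sqrtr_ge0 _; have q0 : 0 <= q := sqrtr_ge0 _.
have pP : p ^+ 2 = P by rewrite sqr_sqrtr.
have qQ : q ^+ 2 = Q by rewrite sqr_sqrtr.
(* AM-GM termwise: 2 p q a b <= q^2 a^2 + p^2 b^2 *)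
have ab : \sum_i a i * b i <= p * q.
  (* Cancelling p q needs it nonzero; otherwise one of the two families vanishes. *)
  have [pq0|pq0] := eqVneq (p * q) 0; last first.
    have pq_gt0 : 0 < p * q by rewrite lt_neqAle eq_sym pq0 mulr_ge0.
    rewrite -(ler_pM2l pq_gt0) mulr_sumr.
    have : \sum_i p * q * (a i * b i) <=
        \sum_i (q ^+ 2 / 2 * a i ^+ 2 + p ^+ 2 / 2 * b i ^+ 2).
      apply: ler_sum => i _; have := sqr_ge0 (q * a i - p * b i); lra.
    rewrite big_split/= -!mulr_sumr -/P -/Q -pP -qQ => /le_trans; apply.
    by rewrite le_eqVlt; apply/orP; left; apply/eqP; field.
  rewrite pq0 big1// => i _; apply/eqP; rewrite mulf_eq0.
  have z c : \sum_i c i ^+ 2 = 0 -> c i == 0 :> R.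
    move=> /eqP; rewrite psumr_eq0 => [/allP/(_ i)|j _]; last exact: sqr_ge0.
    by rewrite mem_index_enum sqrf_eq0 => /(_ isT).
  by move/eqP: pq0; rewrite mulf_eq0 => /orP[] /eqP s0; apply/orP; [left|right];
    apply: z; rewrite -/P -/Q -?pP -?qQ s0 expr0n.
rewrite -(ger0_norm (addr_ge0 p0 q0)) -sqrtr_sqr ler_wsqrtr//.
under eq_bigr do rewrite sqrrD.
rewrite !big_split/= -/P -/Q sqrrD pP qQ lerD2r lerD2l.
by rewrite mulr2n lerD.
Qed.

Section ProductMetric.
Context {R : realType} {C : normedModType R} (n : nat).
Context (B : set (dual C)) (dB : dual C -> dual C -> R).
Hypothesis n_gt0 : (0 < n)%N.
Hypothesis dB_metric : metric_on B dB.

Let dB_ge0 := metric_on_ge0 dB_metric.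
Let n0 : 0 < n%:R^-1 :> R. Proof. by rewrite invr_gt0 ltr0n. Qed.
Let nR0 : 0 < n%:R :> R. Proof. by rewrite ltr0n. Qed.

Implicit Types p q : particles C n.

Lemma sqr_dist_n p q : dist_n dB p q ^+ 2 =
  n%:R^-1 * \sum_(j < n) (`|p.1 j - q.1 j| ^+ 2 + dB (p.2 j) (q.2 j) ^+ 2).
Proof.
rewrite sqr_sqrtr// mulr_ge0// ?(ltW n0)// sumr_ge0// => j _.
by rewrite addr_ge0 ?sqr_ge0.
Qed.

(** All 2n coordinate distances form one family, which makes [dist_n] a scaled Euclidean norm to
    which [minkowski_sum] applies. *)
Let comp p q (i : 'I_n + 'I_n) : R :=
  match i with inl j => `|p.1 j - q.1 j| | inr j => dB (p.2 j) (q.2 j) end.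

Let dist_nE p q :
  dist_n dB p q = Num.sqrt n%:R^-1 * Num.sqrt (\sum_i comp p q i ^+ 2).
Proof.
by rewrite /dist_n sqrtrM ?(ltW n0)// big_sumType/= big_split.
Qed.

Let comp_ge0 p q i : Omega n B p -> Omega n B q -> 0 <= comp p q i.
Proof. by move=> [_ Bp] [_ Bq]; case: i => j //=; exact: dB_ge0. Qed.

Lemma dist_n_ge0 p q : 0 <= dist_n dB p q. Proof. exact: sqrtr_ge0. Qed.

Let comp_le p q i : Omega n B p -> Omega n B q ->
  comp p q i <= Num.sqrt n%:R * dist_n dB p q.
Proof.
move=> Op Oq; rewrite dist_nE mulrA -sqrtrM// divff ?gt_eqF// sqrtr1 mul1r.
rewrite -[leLHS]ger0_norm ?comp_ge0// -sqrtr_sqr ler_wsqrtr//.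
by rewrite (bigD1 i)//= lerDl sumr_ge0// => k _; exact: sqr_ge0.
Qed.

Lemma coef_dist_n p q j : Omega n B p -> Omega n B q ->
  `|p.1 j - q.1 j| <= Num.sqrt n%:R * dist_n dB p q.
Proof. exact: (comp_le (inl j)). Qed.

Lemma point_dist_n p q j : Omega n B p -> Omega n B q ->
  dB (p.2 j) (q.2 j) <= Num.sqrt n%:R * dist_n dB p q.
Proof. exact: (comp_le (inr j)). Qed.

Lemma dist_n_metric : metric_on (Omega n B) (dist_n dB).
Proof.
have [dxx d0 dC dT] := dB_metric; split.
- move=> p [_ Bp]; rewrite /dist_n big1 ?mulr0 ?sqrtr0// => j _.
  by rewrite subrr normr0 dxx// expr0n addr0.
- move=> p q Op Oq pq0; have := Op; have := Oq => -[_ Bq] [_ Bp].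
  rewrite (surjective_pairing p) (surjective_pairing q); congr pair.
    apply/funext => j; apply/subr0_eq/eqP; rewrite -normr_le0.
    by have := coef_dist_n j Op Oq; rewrite pq0 mulr0.
  apply/funext => j; apply: d0 => //; apply/eqP; rewrite eq_le dB_ge0// andbT.
  by have := point_dist_n j Op Oq; rewrite pq0 mulr0.
- move=> p q [_ Bp] [_ Bq]; rewrite /dist_n; congr (Num.sqrt (_ * _)).
  by apply: eq_bigr => j _; rewrite distrC dC.
- move=> p q r Op Oq Or; rewrite !dist_nE -mulrDr ler_wpM2l ?sqrtr_ge0//.
  apply: le_trans (minkowski_sum _ _); apply: ler_wsqrtr.
  apply: ler_sum => i _; rewrite lerXn2r ?nnegrE ?addr_ge0 ?comp_ge0//.
  case: i => j /=; first by rewrite (le_trans _ (ler_normD _ _))// addrA subrK.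
  by apply: dT; [case: Op|case: Oq|case: Or].
Qed.

Lemma dist_n_le_sum p q : Omega n B p -> Omega n B q ->
  dist_n dB p q <= \sum_(j < n) (`|p.1 j - q.1 j| + dB (p.2 j) (q.2 j)).
Proof.
move=> [_ Bp] [_ Bq].
set f := fun j => `|p.1 j - q.1 j| + dB (p.2 j) (q.2 j).
have f0 j : 0 <= f j by rewrite addr_ge0// dB_ge0.
have S0 : 0 <= \sum_j f j by exact: sumr_ge0.
rewrite -[leRHS]ger0_norm// -sqrtr_sqr ler_wsqrtr//.
rewrite mulrC ler_pdivrMr// mulr_natr.
set S := (X in _ <= X ^+ 2 *+ _) in S0 *.
have -> : S ^+ 2 *+ n = \sum_(j < n) S ^+ 2 by rewrite sumr_const card_ord.
apply: ler_sum => j _.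
have fj : f j <= \sum_j f j by rewrite (bigD1 j)//= lerDl sumr_ge0.
apply: le_trans (_ : f j ^+ 2 <= _); last by rewrite lerXn2r ?nnegrE.
by rewrite /f; have := dB_ge0 (Bp j) (Bq j); have := normr_ge0 (p.1 j - q.1 j); nra.
Qed.

Lemma dist_n_cvg0 (u : nat -> particles C n) p :
  (forall k, Omega n B (u k)) -> Omega n B p ->
  dist_n dB (u k) p @[k --> \oo] --> 0 <->
  (forall j, (u k).1 j @[k --> \oo] --> p.1 j /\
             dB ((u k).2 j) (p.2 j) @[k --> \oo] --> 0).
Proof.
move=> Ou Op; split=> [up j|up].
  have h : Num.sqrt n%:R * dist_n dB (u k) p @[k --> \oo] --> 0.
    by rewrite -(mulr0 (Num.sqrt n%:R)); exact: cvgMr.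
  split; first by apply: (cvg_dist_le (V := R^o) _ h) => k; exact: coef_dist_n.
  apply: (cvg_dist_le (V := R^o) _ h) => k; rewrite subr0 ger0_norm.
    exact: point_dist_n.
  by apply: dB_ge0; [case: (Ou k)|case: Op].
pose f k := \sum_(j < n) (`|(u k).1 j - p.1 j| + dB ((u k).2 j) (p.2 j)).
apply: (cvg_dist_le (V := R^o) (v := f)) => [k|].
  by rewrite subr0 ger0_norm ?dist_n_ge0//; exact: dist_n_le_sum.
have -> : 0 = \sum_(j < n) (`|p.1 j - p.1 j| + 0) :> R.
  by rewrite big1// => j _; rewrite subrr normr0 addr0.
rewrite /f; apply: cvg_big => [|j _]; first exact: add_continuous.
have [u1 u2] := up j; apply: cvgD => //.
by apply: cvg_norm; apply: cvgB => //; exact: cvg_cst.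
Qed.

End ProductMetric.

(** * Compactness of bounded configurations and curves between configurations *)

Lemma seq_compact_segment {R : realType} (a b : R) :
  seq_compact [set x | a <= x <= b] (fun x y => `|x - y|).
Proof.
move=> u uab.
have ub : bounded_fun u.
  exists (`|a| + `|b|); split; first exact: num_real.
  move=> M abM k _; apply: le_trans (ltW abM).
  have /andP[au ub] := uab k.
  by case: (ger0P (u k)); case: (ger0P a); case: (ger0P b); lra.
have [phi phi_incr /cvg_ex[l ul]] := bolzano_weierstrass ub.
have phik k : (k <= phi k)%N.
  elim: k => // k /leq_ltn_trans; apply.
  by move/increasing_seqP : phi_incr; exact.
exists phi, l; split=> //; last first.
  rewrite -(normr0 R) -(subrr l); apply: cvg_norm; apply: cvgB => //.
  exact: cvg_cst.
by apply/andP; split; [apply: (ler_cvg_to (cvg_cst a) ul)|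
  apply: (ler_cvg_to ul (cvg_cst b))]; apply: nearW => k;
  case/andP: (uab (phi k)).
Qed.

(** One extraction per index, along the enumeration of [I]; each preserves the limits already
    obtained. *)
Lemma seq_compact_fin {R : realType} {T : Type} (X : set T) (d : T -> T -> R)
    (I : finType) (u : nat -> I -> T) :
  seq_compact X d -> (forall k i, X (u k i)) ->
  exists phi l, [/\ forall k, (k <= phi k)%N, forall i, X (l i) &
    forall i, d (u (phi k) i) (l i) @[k --> \oo] --> 0].
Proof.
move=> Xc Xu.
suff [phi [l [phik Xl ul]]] : exists phi l, [/\ forall k, (k <= phi k)%N,
    forall i, X (l i) & forall i, i \in enum I ->
      d (u (phi k) i) (l i) @[k --> \oo] --> 0].
  by exists phi, l; split=> // i; apply: ul; rewrite mem_enum.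
(* Before any index is treated, [u 0] merely fills the place of the limits. *)
elim: (enum I) => [|j s [phi [l [phik Xl ul]]]]; first by exists id, (u 0%N).
have [psi [lj [psik Xlj ulj]]] := Xc (fun k => u (phi k) j) (fun k => Xu _ _).
exists (phi \o psi), (fun i => if i == j then lj else l i); split.
- by move=> k /=; rewrite (leq_trans (psik k)).
- by move=> i; case: ifP.
- move=> i; rewrite inE; have [-> _ //|_ /= /ul] := eqVneq i j.
  exact: (cvg_subseq (u := fun k => d (u (phi k) i) (l i))).
Qed.

Lemma enorm_coord {R : realType} (n : nat) (c : 'I_n -> R) j : `|c j| <= enorm c.
Proof.
rewrite -sqrtr_sqr ler_wsqrtr// (bigD1 j)//= lerDl.
by apply: sumr_ge0 => i _; exact: sqr_ge0.
Qed.

Lemma sqr_enorm {R : realType} (n : nat) (c : 'I_n -> R) :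
  enorm c ^+ 2 = \sum_(j < n) c j ^+ 2.
Proof. by rewrite sqr_sqrtr// sumr_ge0// => j _; exact: sqr_ge0. Qed.

Lemma enorm_cvg {R : realType} (n : nat) (u : nat -> 'I_n -> R) c :
  (forall j, u k j @[k --> \oo] --> c j) -> enorm (u k) @[k --> \oo] --> enorm c.
Proof.
move=> uc; apply: (cvg_comp _ Num.sqrt); last exact: sqrt_continuous.
apply: cvg_big => [|j _]; first exact: add_continuous.
by rewrite expr2; under eq_fun do rewrite expr2; exact: cvgM.
Qed.

Lemma enorm_convex {R : realType} (n : nat) (b c : 'I_n -> R) (r t : R) :
  enorm b <= r -> enorm c <= r -> 0 <= t <= 1 ->
  enorm (fun j => (1 - t) * b j + t * c j) <= r.
Proof.
move=> br cr /andP[t0 t1]; have r0 : 0 <= r := le_trans (sqrtr_ge0 _) br.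
rewrite -[leRHS]ger0_norm// -sqrtr_sqr ler_wsqrtr//.
have sq c' : enorm c' <= r -> \sum_(j < n) c' j ^+ 2 <= r ^+ 2.
  by move=> c'r; rewrite -sqr_enorm lerXn2r ?nnegrE// sqrtr_ge0.
have := sq _ br; have := sq _ cr => cr2 br2.
apply: (@le_trans _ _ ((1 - t) * (\sum_j b j ^+ 2) + t * (\sum_j c j ^+ 2)));
  last nra.
rewrite !mulr_sumr -big_split/=; apply: ler_sum => j _.
have : 0 <= t * (1 - t) * (b j - c j) ^+ 2.
  by rewrite mulr_ge0 ?sqr_ge0// mulr_ge0// subr_ge0.
lra.
Qed.

Definition Omega_le {R : realType} {C : normedModType R} (n : nat)
    (B : set (dual C)) (r : R) : set (particles C n) :=
  [set p | Omega n B p /\ enorm p.1 <= r].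

Section ProductCompact.
Context {R : realType} {C : normedModType R} (n : nat).
Context (B : set (dual C)) (dB : dual C -> dual C -> R).
Hypothesis n_gt0 : (0 < n)%N.
Hypothesis dB_metric : metric_on B dB.

Lemma seq_compact_Omega_le (r : R) : seq_compact B dB ->
  seq_compact (@Omega_le R C n B r) (dist_n dB).
Proof.
move=> Bc p Op.
have c0r k j : 0 <= (p k).1 j <= r.
  have [[c0 _] cr] := Op k; rewrite c0 (le_trans (ler_norm _))//.
  exact: le_trans (enorm_coord _ _) cr.
have [phi [c [phik c_in pc]]] :=
  seq_compact_fin (seq_compact_segment (a := 0) (b := r)) c0r.
have [psi [u [psik Bu pu]]] := seq_compact_fin Bc
  (fun k j => (Op (phi k)).1.2 j).
have phipsi k : (k <= phi (psi k))%N := leq_trans (psik k) (phik _).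
have pc' j : (p (phi (psi k))).1 j @[k --> \oo] --> c j.
  apply: (cvg_subseq (u := fun k => (p (phi k)).1 j)) => //.
  apply: (cvg_dist_le (V := R^o) _ (pc j)) => k; exact: lexx.
have Oc : Omega n B (c, u) by split=> //= j; case/andP: (c_in j).
exists (phi \o psi), (c, u); split=> //.
  split=> //=; apply: (ler_cvg_to (enorm_cvg pc') (cvg_cst r)).
  by apply: nearW => k; case: (Op (phi (psi k))).
apply/(dist_n_cvg0 n_gt0 dB_metric) => // k; exact: (Op _).1.
Qed.

(** The inequality is additive over coordinates: it is [NPC] for the points, and an equality for the
    affine coefficients. *)
Lemma Omega_curve (g : 'I_n -> R -> dual C) (p q : particles C n) (t : R) :
  NPC B dB ->
  (forall j, [/\ geodesic B dB (g j), g j 0 = p.2 j & g j 1 = q.2 j]) ->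
  Omega n B p -> Omega n B q -> 0 <= t <= 1 ->
  let pt : particles C n := (fun j => (1 - t) * p.1 j + t * q.1 j, fun j => g j t) in
  Omega n B pt /\ forall w, Omega n B w ->
    dist_n dB pt w ^+ 2 <= (1 - t) * dist_n dB p w ^+ 2
      + t * dist_n dB q w ^+ 2 - t * (1 - t) * dist_n dB p q ^+ 2.
Proof.
move=> npc gP [p0 Bp] [q0 Bq] t01 pt; have /andP[t0 t1] := t01.
split.
  split=> j /=; first by rewrite addr_ge0// mulr_ge0// subr_ge0.
  by have [[Bg _] _ _] := gP j; exact: Bg.
move=> w [w0 Bw]; rewrite !sqr_dist_n//.
rewrite !(mulrCA _ n%:R^-1) -mulrDr -mulrBr ler_pM2l ?invr_gt0 ?ltr0n//.
rewrite !mulr_sumr -big_split/= -sumrB; apply: ler_sum => j _ /=.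
have [gj gj0 gj1] := gP j; have := npc _ _ _ gj (Bw j) t01.
rewrite gj0 gj1 !real_normK ?num_real//; lra.
Qed.

End ProductCompact.

(** * Semiconvexity of the energy *)

Lemma dual_val_le {R : realType} {V : normedModType R} (u : dual V) (x : V) :
  `|u x| <= `|u| * `|x|.
Proof.
have [->|x0] := eqVneq x 0.
  by rewrite -[X in `|X|]/(u 0) linear0 !normr0 mulr0.
rewrite -ler_pdivrMr ?normr_gt0// mulrC -[X in X * _]ger0_norm ?invr_ge0//.
rewrite -normrM.
have := @dual_norm_ge _ _ u (`|x|^-1 *: x); rewrite normfZV// lexx => /(_ isT).
by rewrite linearZ.
Qed.

Section Hilbert.
Context {R : realType} {Y : normedModType R} (dot : {symmetric Y}).
Hypothesis dotE : forall y : Y, dot y y = `|y| ^+ 2.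

(** Cauchy-Schwarz follows from the triangle inequality for the norm, by expanding the square of |x
    + y| <= |x| + |y|. *)
Lemma dot_le (x y : Y) : dot x y <= `|x| * `|y|.
Proof.
have := dotE (x + y); rewrite linearDl /= !linearDr/= !dotE.
have -> : dot y x = dot x y by rewrite hermC expr0 mul1r.
have := ler_normD x y; have := normr_ge0 (x + y); nra.
Qed.

Lemma dot_norm_le (x y : Y) : `|dot x y| <= `|x| * `|y|.
Proof.
rewrite ler_norml dot_le andbT lerNl.
by have := dot_le x (- y); rewrite linearNr normrN.
Qed.

End Hilbert.

Section MeanValue.
Context {R : realType}.

Lemma is_derive01_le (g : R -> R) t l : is_derive01 g t l ->
  forall e, 0 < e -> exists2 h, 0 < h & forall s, 0 <= s <= 1 -> `|s - t| < h ->
    `|g s - g t - l * (s - t)| <= e * `|s - t|.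
Proof.
move=> /cvgrPdist_le gl e /gl; rewrite near_withinE.
rewrite /dnbhs near_withinE => /nbhs_ballP[h /= h0 hP]; exists h => // s s01 st.
have [->|s_t] := eqVneq s t; first by rewrite !subrr mulr0 subrr normr0 mulr0.
have st0 : s - t != 0 by rewrite subr_eq0.
have := hP s; rewrite /ball/= distrC => /(_ st s_t); rewrite in_itv/= => /(_ s01).
rewrite -(ler_pM2r (_ : 0 < `|s - t|)) ?normr_gt0// -normrM mulrBl divfK//.
by rewrite distrC.
Qed.

(** Relative derivatives are two-sided in the interior and give continuity up to the endpoints, as
    the mean value theorem requires. *)
Lemma MVT01 (g dg : R -> R) (a b : R) :
  (forall t, 0 <= t <= 1 -> is_derive01 g t (dg t)) ->
  0 <= a -> a <= b -> b <= 1 ->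
  exists2 c, a <= c <= b & g b - g a = dg c * (b - a).
Proof.
move=> gP a0 ab b1.
have [||c] := @MVT_segment _ g dg a b ab; last by rewrite in_itv; exists c.
- move=> x; rewrite in_itv/= => /andP[ax xb].
  have x01 : 0 <= x <= 1 by rewrite (le_trans a0 (ltW ax)) (le_trans (ltW xb)).
  suff H : h^-1 *: ((g \o shift x) (h *: 1) - g x) @[h --> 0^'] --> (dg x : R^o).
    apply: DeriveDef; first by apply/cvg_ex; exists (dg x).
    exact: (cvg_lim (@Rhausdorff R) H).
  apply/cvgrPdist_le => e e0.
  have [h h0 hP] := is_derive01_le (gP x x01) e0.
  rewrite /dnbhs near_withinE; apply/nbhs_ballP.
  exists (Num.min h (Num.min (x - a) (b - x))) => /=.
    by rewrite !lt_min h0 !subr_gt0 ax.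
  move=> k; rewrite /ball/= sub0r normrN !lt_min => /and3P[kh kxa kbx] k0.
  have := hP (k + x); rewrite addrK => /(_ _ kh).
  have -> : 0 <= k + x <= 1.
    by move: kxa kbx; case: (ger0P k) => ? ? ?; apply/andP; split; lra.
  move=> /(_ isT); rewrite -(ler_pM2l (_ : 0 < `|k|^-1)) ?invr_gt0 ?normr_gt0//.
  rewrite mulrCA mulVf ?mulr1 ?normr_eq0// -normfV -normrM mulrBr.
  by rewrite (mulrC _ k) mulKf// distrC /shift/= -[k *: 1]/(k * 1) mulr1.
- apply/subspace_continuousP => x /=; rewrite in_itv/= => /andP[ax xb].
  have x01 : 0 <= x <= 1 by rewrite (le_trans a0 ax) (le_trans xb).
  apply/cvgrPdist_le => e e0.
  (* With e = 1 the expansion bounds the increments of g from x by 1 + |dg x| times the distance. *)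
  have [h h0 hP] := is_derive01_le (gP x x01) ltr01.
  have l0 : 0 < 1 + `|dg x| by rewrite ltr_pwDl.
  rewrite near_withinE; apply/nbhs_ballP.
  exists (Num.min h (e / (1 + `|dg x|))) => /=; first by rewrite lt_min h0 divr_gt0.
  move=> s; rewrite /ball/= lt_min distrC => /andP[sh se].
  rewrite in_itv/= => /andP[sa sb].
  have := hP s; rewrite (le_trans a0 sa) (le_trans sb b1) => /(_ isT sh) gs.
  rewrite distrC; have := ler_normD (g s - g x - dg x * (s - x)) (dg x * (s - x)).
  rewrite subrK normrM; move: se; rewrite ltr_pdivlMr//; lra.
Qed.

(** The mean value theorem on [0, t] and on [t, 1] turns the defect into t (1 - t) (dg y - dg x); a
    third use, for dg, bounds it. *)
Lemma chord_le (g dg ddg : R -> R) (A : R) (t : R) : 0 <= A ->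
  (forall t, 0 <= t <= 1 -> is_derive01 g t (dg t)) ->
  (forall t, 0 <= t <= 1 -> is_derive01 dg t (ddg t)) ->
  (forall t, 0 <= t <= 1 -> `|ddg t| <= A) -> 0 <= t <= 1 ->
  (1 - t) * g 0 + t * g 1 - g t <= A * (t * (1 - t)).
Proof.
move=> A0 gP dgP ddgA /andP[t0 t1].
have [x /andP[x0 xt] gx] := MVT01 gP (lexx 0) t0 t1.
have [y /andP[ty y1] gy] := MVT01 gP t0 t1 (lexx 1).
have [z /andP[xz zy] gz] := MVT01 dgP x0 (le_trans xt ty) y1.
have := ddgA z; rewrite (le_trans x0 xz) (le_trans zy y1) => /(_ isT) zA.
have : dg y - dg x <= A.
  rewrite gz (le_trans (ler_norm _))// normrM (@ger0_norm _ (y - x)) ?subr_ge0//;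
    last lra.
  have : `|ddg z| * (y - x) <= A * 1 by rewrite ler_pM//; lra.
  by rewrite mulr1.
have tt : 0 <= t * (1 - t) by rewrite mulr_ge0// subr_ge0.
have -> : (1 - t) * g 0 + t * g 1 - g t =
  t * (g 1 - g t) - (1 - t) * (g t - g 0) by ring.
rewrite gy gx subr0 => h; have := ler_wpM2l tt h; lra.
Qed.

End MeanValue.

Section Convexity.
Context {R : realType} {Y : normedModType R} (F : Y -> R^o).

Lemma convex_functionE : convex_function [set: Y] F ->
  forall x y s, 0 <= s <= 1 ->
    F (s *: x + (1 - s) *: y) <= s * F x + (1 - s) * F y.
Proof.
move=> Fc x y s /andP[s0 s1].
by have := Fc (Itv01 s0 s1) x y (mem_setT _) (mem_setT _).
Qed.

(** By convexity, the difference quotients in the direction y - x are at most F y - F x for steps in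
    (0, 1]. *)
Lemma convex_gradient x y : convex_function [set: Y] F -> differentiable F x ->
  F x + 'd F x (y - x) <= F y.
Proof.
move=> /convex_functionE Fc Fx.
have dF := @diff_derivable _ _ _ _ _ (y - x) Fx.
rewrite -lerBrDl -deriveE//.
apply: (ler_cvg_to (cvg_dnbhs_at_right dF) (cvg_cst (F y - F x))).
near=> h; have h0 : 0 < h by near: h; exact: nbhs_right_gt.
have h1 : h <= 1 by near: h; exact: nbhs_right_le.
have /= := Fc y x h; rewrite (ltW h0) h1 => /(_ isT).
have -> : h *: y + (1 - h) *: x = h *: (y - x) + x.
  by rewrite scalerBl scale1r scalerBr [LHS]addrA [LHS]addrAC.
move=> Fh; rewrite -[X in X <= _]/(h^-1 * (F (h *: (y - x) + x) - F x)).
rewrite ler_pdivrMl//; lra.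
Unshelve. all: by end_near. Qed.

End Convexity.

Section Energy.
Context {R : realType} {C Y : normedModType R} (dot : {symmetric Y}).
Hypothesis dotE : forall y : Y, dot y y = `|y| ^+ 2.
Context (K : dual C -> Y) (F : Y -> R^o).
Context (B : set (dual C)) (dB : dual C -> dual C -> R) (n : nat).
Hypothesis n_gt0 : (0 < n)%N.
Hypothesis dB_metric : metric_on B dB.
Hypothesis K_cont : seq_continuous B dB K.

Implicit Types p q : particles C n.

Definition mean_obs p : Y := n%:R^-1 *: \sum_(j < n) p.1 j ^+ 2 *: K (p.2 j).

Definition real_energy p : R := F (mean_obs p) + n%:R^-1 * enorm p.1 ^+ 2.

Lemma mean_obs_cont : seq_continuous (Omega n B) (dist_n dB) mean_obs.
Proof.
move=> p q Op Oq /(dist_n_cvg0 n_gt0 dB_metric _ Oq) pq.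
apply: cvgZr; apply: cvg_big => [|j _]; first exact: add_continuous.
have [pq1 pq2] := pq Op j; apply: cvgZ.
  by rewrite expr2; under eq_fun do rewrite expr2; exact: cvgM.
by apply: K_cont => // [k|]; [case: (Op k)|case: Oq].
Qed.

Lemma real_energy_cont : continuous F ->
  seq_continuous (Omega n B) (dist_n dB) real_energy.
Proof.
move=> Fc p q Op Oq pq; apply: cvgD.
  by apply: (cvg_comp _ F _ (Fc _)); exact: mean_obs_cont.
apply: cvgMr; rewrite expr2; under eq_fun do rewrite expr2.
have h : enorm (p k).1 @[k --> \oo] --> enorm q.1.
  apply: enorm_cvg => j.
  by have [] := (dist_n_cvg0 n_gt0 dB_metric Op Oq).1 pq j.
exact: cvgM.
Qed.

Lemma Omega_le_sub r : Omega_le B r `<=` Omega n B. Proof. by move=> p []. Qed.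

Lemma seq_continuous_sub {T : Type} {V : topologicalType} (X Z : set T)
    (d : T -> T -> R) (f : T -> V) :
  X `<=` Z -> seq_continuous Z d f -> seq_continuous X d f.
Proof. by move=> XZ fc u l Xu Xl; apply: fc => [k|]; exact: XZ. Qed.

(** Coercivity in the coefficients, the source of compact sublevel sets. *)
Lemma enorm_le_energy b p : (forall y, b <= F y) ->
  enorm p.1 ^+ 2 <= n%:R * (real_energy p - b).
Proof.
move=> bF; rewrite -ler_pdivrMl ?ltr0n// /real_energy; have := bF (mean_obs p); lra.
Qed.

Context (M : R).
Hypothesis M0 : 0 <= M.
Hypothesis K_geodesic : forall g : R -> dual C, geodesic B dB g ->
  exists w1 w2 : R -> Y,
    [/\ is_weak_derive01 dot (K \o g) w1, is_weak_derive01 dot w1 w2 &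
        forall t : R, 0 <= t <= 1 ->
          `|w1 t| <= M * dB (g 0) (g 1) /\ `|w2 t| <= M * dB (g 0) (g 1) ^+ 2].

(* Testing the defect of c^2 K u against a fixed e reduces the chord estimate to
   scalar functions. *)
Lemma weighted_chord_le (g : R -> dual C) (a b c r N t : R) (e : Y) :
  geodesic B dB g -> (forall u, B u -> `|K u| <= N) ->
  `|a| <= r -> `|b| <= r -> 0 <= t <= 1 ->
  c = (1 - t) * a + t * b ->
  (1 - t) * a ^+ 2 * dot (K (g 0)) e + t * b ^+ 2 * dot (K (g 1)) e
    - c ^+ 2 * dot (K (g t)) e <=
  (r ^+ 2 * M + r * M + N) * `|e| * (t * (1 - t)) *
    (`|a - b| ^+ 2 + dB (g 0) (g 1) ^+ 2).
Proof.
move=> gP KN ar br t01 cE; have [w1 [w2 [dw1 dw2 wM]]] := K_geodesic gP.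
have Bg s : 0 <= s <= 1 -> B (g s) by case: gP => + _; exact.
have B0 : B (g 0) by apply: Bg; lra.
have B1 : B (g 1) by apply: Bg; lra.
set D := dB (g 0) (g 1) in wM *.
have D0 : 0 <= D by exact: (metric_on_ge0 dB_metric B0 B1).
have e0 : 0 <= `|e| := normr_ge0 e.
have r0 : 0 <= r := le_trans (normr_ge0 a) ar.
have N0 : 0 <= N := le_trans (normr_ge0 _) (KN _ B0).
have /andP[t0 t1] := t01.
have tt : 0 <= t * (1 - t) by rewrite mulr_ge0// subr_ge0.
have chord := @chord_le _ (fun s => dot (K (g s)) e) (fun s => dot (w1 s) e)
  (fun s => dot (w2 s) e) (M * D ^+ 2 * `|e|) t _ (dw1 e) (dw2 e) _ t01.
have {}chord : (1 - t) * dot (K (g 0)) e + t * dot (K (g 1)) e - dot (K (g t)) e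
    <= M * D ^+ 2 * `|e| * (t * (1 - t)).
  apply: chord => [|s s01]; first by rewrite !mulr_ge0// sqr_ge0.
  by rewrite (le_trans (dot_norm_le dotE _ _))// ler_wpM2r//; case: (wM s s01).
have lip : `|dot (K (g 1)) e - dot (K (g 0)) e| <= M * D * `|e|.
  have [s s01 ->] := MVT01 (dw1 e) (lexx 0) ler01 (lexx 1).
  rewrite subr0 mulr1 (le_trans (dot_norm_le dotE _ _))// ler_wpM2r//.
  by case: (wM s s01).
have K1 : `|dot (K (g 1)) e| <= N * `|e|.
  by rewrite (le_trans (dot_norm_le dotE _ _))// ler_wpM2r// KN.
move: chord lip K1; move: (dot (K (g 0)) e) (dot (K (g 1)) e) (dot (K (g t)) e).
move=> k0 k1 kt chord lip K1.
(* The chord defect of K plus the effect of the varying coefficient, by c - a = t (b - a) and b - c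
   = (1 - t) (b - a). *)
have -> : (1 - t) * a ^+ 2 * k0 + t * b ^+ 2 * k1 - c ^+ 2 * kt =
  c ^+ 2 * ((1 - t) * k0 + t * k1 - kt) +
  t * (1 - t) * ((b - a) * ((a + c) * (k1 - k0)) + (b - a) ^+ 2 * k1).
  by rewrite cE; ring.
have cr : `|c| <= r.
  rewrite cE (le_trans (ler_normD _ _))// !normrM (ger0_norm t0).
  rewrite (@ger0_norm _ (1 - t)) ?subr_ge0//.
  have h1t : 0 <= 1 - t by rewrite subr_ge0.
  have := ler_wpM2l h1t ar; have := ler_wpM2l t0 br; lra.
have c2 : c ^+ 2 <= r ^+ 2.
  by rewrite -[c ^+ 2]real_normK ?num_real// lerXn2r ?nnegrE.
have -> : (r ^+ 2 * M + r * M + N) * `|e| * (t * (1 - t)) *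
  (`|a - b| ^+ 2 + D ^+ 2) =
  t * (1 - t) * ((r ^+ 2 * M + r * M + N) * `|e| * (`|a - b| ^+ 2 + D ^+ 2)).
  by ring.
set De := `|a - b|; have De0 : 0 <= De := normr_ge0 _.
have -> : (b - a) ^+ 2 = De ^+ 2 by rewrite /De real_normK ?num_real//; ring.
have MDe : 0 <= M * D ^+ 2 * `|e| by rewrite !mulr_ge0// sqr_ge0.
have h1 : c ^+ 2 * ((1 - t) * k0 + t * k1 - kt) <=
    t * (1 - t) * (r ^+ 2 * (M * D ^+ 2 * `|e|)).
  apply: (le_trans (ler_wpM2l (sqr_ge0 c) chord)).
  have := ler_wpM2r (mulr_ge0 MDe tt) c2; lra.
have h2 : (b - a) * ((a + c) * (k1 - k0)) <= De * (2 * r * (M * D * `|e|)).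
  rewrite (le_trans (ler_norm _))// !normrM -/De distrC -/De ler_wpM2l//.
  rewrite ler_pM// (le_trans (ler_normD _ _))//; lra.
have h3 : De ^+ 2 * k1 <= De ^+ 2 * (N * `|e|).
  by rewrite ler_wpM2l ?sqr_ge0// (le_trans (ler_norm _)).
(* Young: 2 De D <= De^2 + D^2. *)
have h4 : De * (2 * r * (M * D * `|e|)) <= r * M * `|e| * (De ^+ 2 + D ^+ 2).
  have : 0 <= r * M * `|e| by rewrite !mulr_ge0.
  have := sqr_ge0 (De - D); nra.
have h5 : De ^+ 2 * (N * `|e|) <= N * `|e| * (De ^+ 2 + D ^+ 2).
  by rewrite mulrC ler_wpM2l ?mulr_ge0// lerDl sqr_ge0.
have h6 : r ^+ 2 * (M * D ^+ 2 * `|e|) <= r ^+ 2 * M * `|e| * (De ^+ 2 + D ^+ 2).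
  have : 0 <= r ^+ 2 * M * `|e| * De ^+ 2 by rewrite !mulr_ge0// ?sqr_ge0.
  lra.
apply: (le_trans (lerD h1 (lexx _))); rewrite -mulrDr ler_wpM2l//; lra.
Qed.

Lemma dot_mean_obs p e : dot (mean_obs p) e =
  n%:R^-1 * \sum_(j < n) p.1 j ^+ 2 * dot (K (p.2 j)) e.
Proof.
rewrite /mean_obs linearZl_LR /= linear_sumlz; congr (_ * _).
by apply: eq_bigr => j _; rewrite linearZl_LR.
Qed.

Lemma real_energy_semiconvex (r N S : R) (Df : Y -> dual Y) :
  geodesically_complete B dB -> NPC B dB ->
  convex_function [set: Y] F ->
  (forall y, differentiable F y /\ 'd F y = Df y :> (Y -> R^o)) ->
  0 <= S -> (forall p, Omega_le B r p -> `|Df (mean_obs p)| <= S) ->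
  0 <= N -> (forall u, B u -> `|K u| <= N) ->
  semiconvex (Omega_le B r) (dist_n dB) real_energy
    (S * (r ^+ 2 * M + r * M + N)).
Proof.
move=> gc npc Fc FDf S0 DfS N0 KN p q [Op pr] [Oq qr].
have /choice[g gP] j : exists g, [/\ geodesic B dB g, g 0 = p.2 j & g 1 = q.2 j].
  by apply: gc; [case: Op|case: Oq].
pose pt t : particles C n :=
  (fun j => (1 - t) * p.1 j + t * q.1 j, fun j => g j t).
exists pt => t t01; have /andP[t0 t1] := t01.
have [Opt dpt] := Omega_curve n_gt0 npc gP Op Oq t01.
have rt : enorm (pt t).1 <= r by exact: enorm_convex.
split=> //; first by move=> w [Ow _]; exact: dpt.
set k0 := mean_obs p; set k1 := mean_obs q; set kt := mean_obs (pt t).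
set A := r ^+ 2 * M + r * M + N.
have tt : 0 <= t * (1 - t) by rewrite mulr_ge0// subr_ge0.
have r0 : 0 <= r := le_trans (sqrtr_ge0 _) pr.
have A0 : 0 <= A by rewrite !addr_ge0// mulr_ge0// sqr_ge0.
(* The chord of the observations minus their value on the curve. *)
pose e := (1 - t) *: (k0 - kt) + t *: (k1 - kt).
have e_le : `|e| <= A * (t * (1 - t)) * dist_n dB p q ^+ 2.
  have [->|e_neq0] := eqVneq e 0.
    by rewrite normr0 mulr_ge0 ?sqr_ge0// mulr_ge0.
  have e_gt0 : 0 < `|e| by rewrite normr_gt0.
  (* Tested against e itself, the weighted chord estimate has |e|^2 on the left and one factor |e|
     on the right. *)
  rewrite -(ler_pM2l e_gt0) -expr2 -dotE {1}/e.
  rewrite (linearDl dot) /= !(linearZl_LR dot) /= !(linearBl dot) /=.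
  have -> : (1 - t) * (dot k0 e - dot kt e) + t * (dot k1 e - dot kt e) =
    (1 - t) * dot k0 e + t * dot k1 e - dot kt e by ring.
  rewrite !dot_mean_obs sqr_dist_n//.
  rewrite !(mulrCA _ n%:R^-1) -mulrDr -mulrBr ler_pM2l ?invr_gt0 ?ltr0n//.
  rewrite !mulr_sumr -big_split/= -sumrB; apply: ler_sum => j _.
  have [gj gj0 gj1] := gP j.
  have := @weighted_chord_le (g j) (p.1 j) (q.1 j) ((pt t).1 j) r N t e gj KN
    (le_trans (enorm_coord _ _) pr) (le_trans (enorm_coord _ _) qr) t01 erefl.
  rewrite gj0 gj1 -/A !mulrA => /le_trans; apply.
  by rewrite le_eqVlt; apply/orP; left; apply/eqP; ring.
(* The gradient inequalities at kt towards k0 and k1, averaged, leave the derivative in the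
   direction e. *)
have Fconv : F kt <= (1 - t) * F k0 + t * F k1 + S * `|e|.
  have [dF dFE] := FDf kt.
  have t1_ge0 : 0 <= 1 - t by rewrite subr_ge0.
  have h0 := ler_wpM2l t1_ge0 (convex_gradient k0 Fc dF).
  have h1 := ler_wpM2l t0 (convex_gradient k1 Fc dF).
  have de : Df kt e = (1 - t) * 'd F kt (k0 - kt) + t * 'd F kt (k1 - kt).
    by rewrite dFE /e linearD/= !linearZ.
  have := dual_val_le (Df kt) e; rewrite ler_norml => /andP[+ _].
  have := ler_wpM2r (normr_ge0 e) (DfS (pt t) (conj Opt rt)); rewrite -/kt de; lra.
have nc : enorm (pt t).1 ^+ 2 <= (1 - t) * enorm p.1 ^+ 2 + t * enorm q.1 ^+ 2.
  rewrite !sqr_enorm !mulr_sumr -big_split/=; apply: ler_sum => j _.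
  have := mulr_ge0 tt (sqr_ge0 (p.1 j - q.1 j)); lra.
have n0 : 0 <= n%:R^-1 :> R by rewrite invr_ge0.
rewrite /real_energy -/k0 -/k1 -/kt.
have := ler_wpM2l n0 nc; have := ler_wpM2l S0 e_le; lra.
Qed.

End Energy.

(** * Weak-* sequential compactness *)

Section WeakStar.
Context {R : realType} {C : normedModType R}.

Lemma eval_weak_star_continuous (x : C) :
  continuous (fun u : weak_star C => (u : dual C) x).
Proof.
move=> u; apply: (@continuous_comp _ _ _
  (fun v : weak_star C => (v : dual C) : {ptws C -> R^o})
  (fun f : {ptws C -> R^o} => f x)); first exact: initial_continuous.
exact: proj_continuous.
Qed.

Lemma dual_dense_eq (D : set C) (u v : dual C) : dense D ->
  (forall x, D x -> u x = v x) -> u = v.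
Proof.
move=> Dd uv; apply: val_inj; apply/funext => x /=; apply/eqP.
apply/negPn/negP => ux.
pose O := [set y | u y - v y != 0].
have Oo : open O.
  apply: (@open_comp _ _ (fun y => u y - v y) [set z | z != 0]);
    last exact: open_neq.
  by move=> y _; apply: continuousB; exact: dual_continuous.
have [|y [Oy Dy]] := Dd O _ Oo; first by exists x; rewrite /O/= subr_eq0.
by move: Oy; rewrite /O/= uv// subrr eqxx.
Qed.

Lemma countable_enum (D : set C) : countable D ->
  exists x : nat -> C, forall y, D y -> exists k, y = x k.
Proof.
move=> /countable_injP[f finj].
have /choice[x xP] k : exists x, forall y, D y -> f y = k -> y = x.
  have [[x [Dx fx]]|nx] := pselect (exists x, D x /\ f x = k).
    by exists x => y Dy fy; apply: finj; rewrite ?inE// fx.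
  (* Indices that code no point of [D] get the dummy 0; this also covers an empty [D]. *)
  by exists 0 => y Dy fy; case: nx; exists y.
by exists x => y Dy; exists (f y); exact: xP.
Qed.

Lemma compact_cluster_seq (T : topologicalType) (A : set T) (u : nat -> T) :
  compact A -> (forall k, A (u k)) -> A `&` cluster (u @ \oo) !=set0.
Proof. by move=> Ac Au; apply: Ac; exists 0%N => // k _; exact: Au. Qed.

(* Evaluations at a dense sequence separate points: a subsequence that converges
   at each of them has only one weak-* cluster point. *)
Lemma weak_star_seq_compact (A : set (dual C)) (u : nat -> dual C) :
  separable C -> @compact (weak_star C) A -> (forall k, A (u k)) ->
  exists phi l, [/\ forall k, (k <= phi k)%N, A l &
    weak_star_cvg (fun k => u (phi k)) l].
Proof.
move=> [D /countable_enum[x xD] Dd] Ac Au.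
have [l [Al lu]] := @compact_cluster_seq (weak_star C) A u Ac Au.
(* As l is a cluster point, some late u m is close to l at the first k test points. *)
have /choice[phi phiP] k : exists m, (k <= m)%N /\
    forall i : 'I_k, `|u m (x i) - l (x i)| <= k.+1%:R^-1.
  have km : (u @ \oo) [set v : weak_star C | exists2 m, (k <= m)%N & v = u m].
    by exists k => // m /= ?; exists m.
  have lk : nbhs (l : weak_star C)
      [set v | forall i : 'I_k, `|(v : dual C) (x i) - l (x i)| <= k.+1%:R^-1].
    have nb : Filter (nbhs (l : weak_star C)) by exact: nbhs_filter.
    apply: (@filter_forall _ _ (fun (i : 'I_k) (v : weak_star C) =>
      `|(v : dual C) (x i) - l (x i)| <= k.+1%:R^-1) _ nb) => i.
    have := @eval_weak_star_continuous (x i) l; move/cvgrPdist_le.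
    move=> /(_ k.+1%:R^-1); rewrite invr_gt0 ltr0n => /(_ isT).
    by apply: filterS => v /=; rewrite distrC.
  by have [_ [[m ? ->] ?]] := lu _ _ km lk; exists m.
exists phi, l; split=> [k||]; [exact: (phiP k).1|exact: Al|].
have ul i : u (phi k) (x i) @[k --> \oo] --> l (x i).
  apply/cvgrPdist_le => e e0.
  have [N _ NP] : \forall k \near \oo, `|0 - harmonic k| < e.
    by move: e e0; exact/cvgrPdist_lt/cvg_harmonic.
  exists (maxn N i.+1) => // k /=; rewrite geq_max => /andP[Nk ik].
  rewrite distrC (le_trans ((phiP k).2 (Ordinal ik)))//.
  have := NP k Nk; rewrite /= sub0r normrN => /ltW; apply: le_trans.
  exact: ler_norm.
(* Otherwise a further extraction avoids a neighbourhood of l, although its cluster point in [A] can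
   only be l. *)
apply: contrapT => nul.
have [V lV nV] : exists2 V, nbhs (l : weak_star C) V &
    ~ ((fun k => u (phi k) : weak_star C) @ \oo) V.
  by apply: contrapT => /forall2NP h; apply: nul => V lV; have [//|/contrapT] := h V.
have /choice[psi psiP] N : exists k, (N <= k)%N /\ ~ V (u (phi k)).
  apply: contrapT => /forallNP h; apply: nV; exists N => // k /= Nk.
  by apply: contrapT => nVk; exact: (h k).
have [w [Aw wu]] := @compact_cluster_seq (weak_star C) A
  (fun k => u (phi (psi k))) Ac (fun k => Au _).
have wl : w = l.
  apply: (dual_dense_eq Dd) => y /xD[i ->].
  have ulpsi : u (phi (psi k)) (x i) @[k --> \oo] --> l (x i).
    by apply: (cvg_subseq (u := fun k => u (phi k) (x i))) => // k; exact: (psiP k).1.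
  apply/eqP; rewrite -subr_eq0 -normr_le0; apply/ler_addgt0Pr => e e0.
  have e20 : 0 < e / 2 by rewrite divr_gt0.
  have h1 := @eval_weak_star_continuous (x i) w.
  move/cvgrPdist_le/(_ _ e20) : h1 => h1.
  move/cvgrPdist_le/(_ _ e20) : ulpsi => h2.
  have h2' : ((fun k => u (phi (psi k)) : weak_star C) @ \oo)
      [set v : weak_star C | `|l (x i) - (v : dual C) (x i)| <= e / 2] by [].
  have [v [v2 v1]] := wu _ _ h2' h1.
  rewrite add0r -(subrKA ((v : dual C) (x i))).
  rewrite (le_trans (ler_normD _ _))// (splitr e) lerD// distrC//.
have nVpsi : ((fun k => u (phi (psi k)) : weak_star C) @ \oo) (~` V).
  by exists 0%N => // k _; exact: (psiP k).2.
by rewrite wl in wu; have [v [nVv Vv]] := wu _ _ nVpsi lV.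
Qed.

End WeakStar.

(** * Minimizing movements *)

Section MinimizingMovement.
Context {R : realType} {T : Type} (Z X : set T) (d : T -> T -> R).
Context (E : T -> \bar R) (G : T -> R) (L : R).
Hypothesis d_metric : metric_on Z d.
Hypothesis EG : forall z, Z z -> E z = (G z)%:E.
Hypothesis X_sub : X `<=` Z.
Hypothesis X_compact : seq_compact X d.
Hypothesis G_cont : seq_continuous X d G.
Hypothesis L_ge0 : 0 <= L.
Hypothesis G_semiconvex : semiconvex X d G L.

Lemma proximal_minimizer (tau : nat -> R) (xs : nat -> T) :
  Z (xs 0%N) ->
  (forall m, is_minimizer Z
     (fun v => (E v + ((2 * tau m)^-1 * d v (xs m) ^+ 2)%:E)%E) (xs m.+1)) <->
  proximal Z d G tau xs.
Proof.
move=> Z0; split=> [xmin|[_ xprox] m].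
  split=> // m; have [Zm xm] := xmin m; split=> // v Zv.
  by have := xm v Zv; rewrite !EG// -!EFinD lee_fin.
have [Zm xm] := xprox m; split=> // v Zv.
by rewrite !EG// -!EFinD lee_fin xm.
Qed.

(** The flow built in the compact part is also a flow in [Z]: competitors outside [X] have too much
    energy to matter. *)
Lemma mm_exists x0 : Z x0 -> [set z | Z z /\ G z <= G x0 + 1] `<=` X ->
  exists x, minimizing_movement Z d E x0 x.
Proof.
move=> Zx0 ZX; have [dxx _ _ _] := d_metric.
have Xx0 : X x0 by apply: ZX; split=> //; lra.
have [x [xs [xbar [x0E Xx xs0 Sx xbarx]]]] :=
  flow_exists d_metric X_sub X_compact G_cont L_ge0 G_semiconvex Xx0.
exists x; split.
  by split=> //; [rewrite EG// ltry|move=> t /Xx/X_sub].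
exists (fun k _ => k.+1%:R^-1), xs, xbar; split; [|split; [|split]].
- split=> [k m|k|]; [by have [+ _ _ _ _] := Sx k|by have [] := Sx k|].
  have -> : (fun k => ereal_sup (range (fun m : nat => (k.+1%:R^-1)%:E))) =
      (fun k => (harmonic k)%:E) :> (nat -> \bar R).
    apply/funext => k; rewrite (_ : range _ = [set (k.+1%:R^-1)%:E]) ?ereal_sup1//.
    by apply/seteqP; split=> [_ [m _ <-]//|_ ->]; exists 0%N.
  apply: cvg_EFin; first exact: nearW.
  exact: cvg_harmonic.
- split=> [k||| ].
  + by rewrite xs0.
  + move=> k; apply/proximal_minimizer; first by rewrite xs0.
    have [tau0 _ _ P _] := Sx k; have P' := P; case: P => X0 P.
    split=> [|m]; first exact: X_sub.
    have [Xm xm] := P m; split=> [|v Zv]; first exact: X_sub.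
    have [Gv|Gv] := leP (G v) (G x0 + 1); first by apply: xm; exact: ZX.
    (* Here v has more energy than the current point, which does better by not moving. *)
    have Xm' := proximal_in m P'.
    have /le_trans := xm _ Xm'; apply.
    rewrite dxx; last exact: X_sub.
    rewrite expr0n mulr0 addr0.
    have := proximal_nonincr (metric_on_sub d_metric X_sub) tau0 P' (leq0n m).
    rewrite xs0 => Gm.
    apply: le_trans (_ : G v <= _); last first.
      by rewrite lerDl mulr_ge0 ?sqr_ge0// invr_ge0 mulr_ge0.
    by rewrite (le_trans Gm)// (le_trans _ (ltW Gv))// lerDl.
  + by under eq_fun do rewrite xs0; exact: cvg_cst.
  + under eq_fun do rewrite xs0 dxx//.
    have cst0 : (fun=> 0%:E : \bar R) @ \oo --> (0%:E : \bar R).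
      exact: cvg_cst.
    rewrite is_cvg_limn_esupE; last by apply/cvg_ex; exists 0%:E; exact: cst0.
    by rewrite (cvg_lim _ cst0) ?ltry.
- by move=> k; case: (Sx k).
- exact: xbarx.
Qed.

(** Convergence of the initial energies puts the starting points below G x0 + 1 for large k;
    energies then decrease, so the schemes stay in [X]. *)
Lemma mm_schemes x0 x : [set z | Z z /\ G z <= G x0 + 1] `<=` X ->
  minimizing_movement Z d E x0 x ->
  exists tau xs xbar, [/\ forall k, Z (xs k 0%N),
    forall k t, 0 <= t -> Z (xbar k t),
    d (xs k 0%N) x0 @[k --> \oo] --> 0,
    forall t, 0 <= t -> d (xbar k t) (x t) @[k --> \oo] --> 0 &
    forall eta, 0 < eta -> \forall k \near \oo,
      scheme X d G eta (tau k) (xs k) (xbar k)].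
Proof.
move=> ZX [[Zx0 _ x0E Zx] [tau [xs [xbar]]]].
move=> [[tau0 tauoo tau_sup] [[Zxs xmin Exs _] [xbarI xbarx]]].
have P k : proximal Z d G (tau k) (xs k) by apply/proximal_minimizer.
exists tau, xs, xbar; split=> //.
- by move=> k t t0; exact: (interpolation_in (tauoo k) (P k) (xbarI k) t0).
(* Convergence of the initial points is the convergence of the interpolations at time 0. *)
- have := xbarx 0 (lexx 0); rewrite x0E.
  by under eq_fun do rewrite (xbarI _).1.
- move=> eta eta0.
  have Gxs : G (xs k 0%N) @[k --> \oo] --> G x0.
    move: Exs; rewrite EG//; under eq_fun do rewrite EG//.
    by move=> /fine_cvg.
  have G1 : \forall k \near \oo, G (xs k 0%N) <= G x0 + 1.
    by apply: (cvgr_le _ Gxs); rewrite ltrDl.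
  have tau_eta : \forall k \near \oo,
      (ereal_sup (range (fun m => (tau k m)%:E)) < eta%:E)%E.
    have eta_gt0 : (0 < eta%:E)%E by rewrite lte_fin.
    exact: tau_sup _ (open_ereal_lt' eta_gt0).
  apply: filterS2 G1 tau_eta => k Gk tk.
  have Xm m : X (xs k m).
    apply: ZX; split; first exact: proximal_in (P k).
    exact: le_trans (proximal_nonincr d_metric (tau0 k) (P k) (leq0n m)) Gk.
  split=> // [m|].
    rewrite -lee_fin (le_trans _ (ltW tk))//; apply: ereal_sup_ubound.
    by exists m.
  split=> [|m]; first exact: Xm.
  split=> [|v Xv]; first exact: Xm.
  by have [_ /(_ m)[_]] := P k; apply; exact: X_sub.
Qed.

Lemma mm_contraction x0 y0 x y (t : R) : Z x0 -> Z y0 ->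
  [set z | Z z /\ G z <= G x0 + 1] `<=` X ->
  [set z | Z z /\ G z <= G y0 + 1] `<=` X ->
  minimizing_movement Z d E x0 x -> minimizing_movement Z d E y0 y ->
  0 <= t -> d (x t) (y t) <= expR (2 * L * t) * d x0 y0.
Proof.
move=> Zx0 Zy0 ZXx ZXy mx my t0.
have [tau [xs [xbar [Zxs Zxbar xs0 xbarx Sx]]]] := mm_schemes ZXx mx.
have [sig [ys [ybar [Zys Zybar ys0 ybary Sy]]]] := mm_schemes ZXy my.
have Zx : Z (x t) by case: mx => -[_ _ _ +] _; exact.
have Zy : Z (y t) by case: my => -[_ _ _ +] _; exact.
have := flow_contraction d_metric X_sub X_compact G_cont L_ge0 G_semiconvex t0
  Sx Sy Zxs Zys (fun k => Zxbar k t t0) (fun k => Zybar k t t0) Zx0 Zy0 Zx Zy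
  xs0 ys0 (xbarx t t0) (ybary t t0).
(* The factor becomes a square, so that the square root can be taken on both sides. *)
rewrite (_ : 4 * L * t = 2%:R * (2 * L * t)); last by ring.
rewrite expRM_natl -exprMn ler_pXn2r// nnegrE.
  exact: metric_on_ge0 d_metric _ _ _ _.
by rewrite mulr_ge0 ?expR_ge0//; exact: metric_on_ge0 d_metric _ _ _ _.
Qed.

Lemma mm_unique x0 x y (t : R) : Z x0 ->
  [set z | Z z /\ G z <= G x0 + 1] `<=` X ->
  minimizing_movement Z d E x0 x -> minimizing_movement Z d E x0 y ->
  0 <= t -> x t = y t.
Proof.
move=> Zx0 ZX mx my t0; have [dxx d0 _ _] := d_metric.
have Zx : Z (x t) by case: mx => -[_ _ _ +] _; exact.
have Zy : Z (y t) by case: my => -[_ _ _ +] _; exact.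
apply: d0 => //; apply/eqP; rewrite eq_le (metric_on_ge0 d_metric)// andbT.
by have := mm_contraction Zx0 Zx0 ZX ZX mx my t0; rewrite dxx// mulr0.
Qed.

End MinimizingMovement.

(** * Existence, uniqueness and contraction for the particle energy *)

Theorem theorem3p19 (R : realType)
  (* the predual, and the real Hilbert space Y *)
  (C : completeNormedModType R) (sepC : separable C)
  (Y : completeNormedModType R) (dot : {symmetric Y})
  (dotE : forall y : Y, dot y y = `|y| ^+ 2)
  (K : dual C -> Y) (F : Y -> R^o) (Reg : dual C -> \bar R)
  (Reg_ge0 : forall u, (0 <= Reg u)%E)
  (* the set B of extremal points and its metric *)
  (B : set (dual C)) (B_neq0 : B !=set0)
  (B_closed : @closed (weak_star C) B) (B_sub : B `<=` Btilde Reg)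
  (dB : dual C -> dual C -> R) (dB_metric : metric_on B dB)
  (dB_weak_star : forall (us : nat -> dual C) (u : dual C),
    (forall k, B (us k)) -> B u ->
    weak_star_cvg us u <->
    dB (us k) u @[k --> \oo] --> 0)
  (dB_geodesic : geodesically_complete B dB)
  (A1_linear : linear K)
  (A1_continuous : continuous (K : weak_star C -> weak Y))
  (A2_bounded : exists b : R, forall y, b <= F y)
  (A2_convex : convex_function [set: Y] F)
  (A2_differentiable : twice_differentiable F)
  (A3_convex : ereal_convex Reg)
  (A3_lsc : @lower_semicontinuous (weak_star C) R Reg)
  (A3_homogeneous : forall (l : R) (u : dual C), 0 <= l ->
    Reg (l *: u) = (l%:E * Reg u)%E)
  (A4 : forall a : R, 0 <= a ->
    @compact (weak_star C) [set u | (Reg u <= a%:E)%E])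
  (A5 : forall (us : nat -> dual C) (u : dual C),
    (forall k, (Reg (us k) < +oo)%E) -> (Reg u < +oo)%E ->
    weak_star_cvg us u ->
    K (us k) @[k --> \oo] --> K u)
  (A6 : forall (n : nat) (a : 'I_n -> R) (u : 'I_n -> dual C),
    (forall j, 0 <= a j) -> (forall j, B (u j)) ->
    Reg (\sum_(j < n) a j *: u j) = (\sum_(j < n) (a j)%:E * Reg (u j))%E)
  (A7 : ~ B 0)
  (A8 : exists2 M : R, 0 < M & forall g : R -> dual C, geodesic B dB g ->
    exists w1 w2 : R -> Y,
      [/\ is_weak_derive01 dot (K \o g) w1, is_weak_derive01 dot w1 w2 &
          forall t : R, 0 <= t <= 1 ->
            `|w1 t| <= M * dB (g 0) (g 1) /\ `|w2 t| <= M * dB (g 0) (g 1) ^+ 2])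
  (Btilde_Reg : forall u, Btilde Reg u -> Reg u = 1%E \/ u = 0)
  (B_NPC : NPC B dB)
  (n : nat) (n_gt0 : (0 < n)%N) :
  let mm := minimizing_movement (Omega n B) (dist_n dB) (energy_n n K F Reg) in
  (forall p0 : particles C n, Omega n B p0 ->
    (exists p, mm p0 p) /\
    forall p q, mm p0 p -> mm p0 q -> forall t : R, 0 <= t -> p t = q t) /\
  exists lambda : R -> R -> R,
    forall (p0 q0 : particles C n) (p q : R -> particles C n),
      Omega n B p0 -> Omega n B q0 -> mm p0 p -> mm q0 q ->
      {ae lebesgue_measure, forall t : R, 0 < t ->
        dist_n dB (p t) (q t) <=
          expR (- lambda (enorm p0.1) (enorm q0.1) * t) * dist_n dB p0 q0}.
Proof.
move=> mm.
have RegB u : B u -> Reg u = 1%E.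
  by move=> Bu; have [//|u0] := Btilde_Reg _ (B_sub _ Bu); case: A7; rewrite -u0.
(* [B] is weak-* closed in a compact sublevel set of [Reg]; separability of the predual makes
   compactness sequential. *)
have B_compact : seq_compact B dB.
  have Bc : @compact (weak_star C) B.
    apply: (subclosed_compact B_closed (A4 _ ler01)) => u /RegB /= ->.
    by rewrite lexx.
  move=> u Bu; have [phi [l [phik Bl ul]]] := weak_star_seq_compact sepC Bc Bu.
  exists phi, l; split=> //.
  exact: (dB_weak_star _ _ (fun k => Bu (phi k)) Bl).1 ul.
have K_cont : seq_continuous B dB K.
  move=> u l Bu Bl ul.
  have {}ul := (dB_weak_star _ _ Bu Bl).2 ul.
  by apply: A5 => // [k|]; rewrite RegB ?ltry.
have [Df FDf] := A2_differentiable.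
have [b bF] := A2_bounded.
have [M M_gt0 A8M] := A8.
have M0 := ltW M_gt0.
have F_cont : continuous F.
  by move=> y; apply: differentiable_continuous; case: (FDf y).
pose G := @real_energy R C Y K F n.
have energyE p : Omega n B p -> energy_n n K F Reg p = (G p)%:E.
  move=> [c0 Bp]; rewrite /energy_n /energy /G /real_energy EFinD.
  have K_mul a u : K (a *: u) = a *: K u.
    have K0 : K 0 = 0.
      by have := A1_linear (-1) 0 0; rewrite scaler0 addr0 scaleN1r addNr.
    by have := A1_linear a u 0; rewrite !addr0 K0 addr0.
  have K_add u v : K (u + v) = K u + K v.
    by have := A1_linear 1 u v; rewrite !scale1r.
  congr (_ + _)%E.
    congr (F _)%:E; rewrite K_mul /mean_obs; congr (_ *: _).
    have K0 : K 0 = 0 by have := K_mul 0 0; rewrite !scale0r.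
    rewrite (big_morph K K_add K0); apply: eq_bigr => j _; exact: K_mul.
  rewrite scaler_sumr; under eq_bigr do rewrite scalerA.
  rewrite A6 => [|j|//]; last by rewrite mulr_ge0 ?sqr_ge0.
  rewrite sqr_enorm mulr_sumr -sumEFin; apply: eq_bigr => j _.
  by rewrite RegB// mule1.
have dn_metric := dist_n_metric n_gt0 dB_metric.
have Oc r := seq_compact_Omega_le n_gt0 dB_metric (r := r) B_compact.
have G_cont r : seq_continuous (Omega_le B r) (dist_n dB) G.
  apply: (seq_continuous_sub (Z := Omega n B)); first exact: Omega_le_sub.
  exact: real_energy_cont.
have [N N0 KN] : exists2 N, 0 <= N & forall u, B u -> `|K u| <= N.
  have [|N N0 KN] := seq_compact_bounded B_compact (f := fun u => `|K u|).
    by move=> u l Bu Bl ul; apply: cvg_norm; exact: K_cont.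
  by exists N => // u /KN; rewrite normr_id.
(* The constant is chosen as a function of the coefficient bound alone; for negative r the set is
   empty. *)
have /choice[L LP] r : exists L, 0 <= L /\
    semiconvex (@Omega_le R C n B r) (dist_n dB) G L.
  have [r0|r_lt0] := leP 0 r; last first.
    exists 0; split=> // p q [_ pr].
    by have := le_lt_trans (le_trans (sqrtr_ge0 _) pr) r_lt0; rewrite ltxx.
  have [|S S0 DfS] := seq_compact_bounded (Oc r)
      (f := fun p => `|Df (mean_obs K p)|).
    move=> p q Op Oq pq; apply: cvg_norm.
    apply: (cvg_comp _ Df); last first.
      by apply: differentiable_continuous; case: (FDf (mean_obs K q)).
    exact: (seq_continuous_sub (@Omega_le_sub _ _ _ _ _)
      (mean_obs_cont n_gt0 dB_metric K_cont)).
  exists (S * (r ^+ 2 * M + r * M + N)); split.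
    by rewrite mulr_ge0// !addr_ge0// mulr_ge0// sqr_ge0.
  apply: (real_energy_semiconvex (Df := Df) dotE n_gt0 dB_metric M0 A8M
    dB_geodesic B_NPC A2_convex _ S0 _ N0 KN) => [y|p /DfS]; first by have [] := FDf y.
  by rewrite normr_id.
(* This bounds the initial energy through the norm of the coefficients only, uniformly in the points
   of [B]. *)
have /choice[H HP] r : exists H, forall p, @Omega_le R C n B r p -> G p <= H.
  have [H _ GH] := seq_compact_bounded (Oc r) (G_cont r).
  by exists H => p /GH; apply: le_trans; exact: ler_norm.
(* By [enorm_le_energy], a bound on the coefficients wherever the energy is at most [H r + 1]. *)
pose rho r := Num.sqrt (n%:R * (H r + 1 - b)).
have sublevel (p0 : particles C n) r : Omega n B p0 -> rho (enorm p0.1) <= r ->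
    [set p | Omega n B p /\ G p <= G p0 + 1] `<=` Omega_le B r.
  move=> Op0 rr p [Op Gp]; split=> //; apply: le_trans rr.
  rewrite -[leLHS]ger0_norm ?sqrtr_ge0// -sqrtr_sqr ler_wsqrtr//.
  apply: (le_trans (enorm_le_energy K n_gt0 p bF)); rewrite ler_wpM2l// lerD2r.
  by rewrite (le_trans Gp)// lerD2r; apply: HP; split.
split=> [p0 Op0|].
  have [L0 LG] := LP (rho (enorm p0.1)).
  have sub := sublevel p0 _ Op0 (lexx _).
  split=> [|p q mp mq t t0].
    exact: (mm_exists dn_metric energyE
    (@Omega_le_sub _ _ _ _ _) (Oc _) (G_cont _) L0 LG).
  exact: (mm_unique dn_metric energyE
    (@Omega_le_sub _ _ _ _ _) (Oc _) (G_cont _) L0 LG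
    Op0 sub mp mq t0).
(* With the maximum, one compact set contains the sublevel sets of both initial points. The estimate
   then holds at every t > 0. *)
exists (fun r s => - (2 * L (Num.max (rho r) (rho s)))) => p0 q0 p q Op0 Oq0 mp mq.
apply: aeW => t t0; rewrite opprK.
have [L0 LG] := LP (Num.max (rho (enorm p0.1)) (rho (enorm q0.1))).
apply: (mm_contraction dn_metric energyE
    (@Omega_le_sub _ _ _ _ _) (Oc _) (G_cont _) L0 LG
  Op0 Oq0 _ _ mp mq (ltW t0)).
  by apply: sublevel => //; rewrite le_max lexx.
by apply: sublevel => //; rewrite le_max lexx orbT.
Qed.
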